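(* Let $u\ge1$, $q,v,r,s>0$, $0\le\theta\le1$, and $\alpha_1,\alpha_2,\alpha_3,\sigma\in\mathbb{R}$ satisfy $n+\alpha_2>0$, $\frac nu+\alpha_3>0$, $\frac nq+\alpha_1>0$, $\sigma\le\alpha_2\le\sigma+1$, $\alpha_1=\theta\sigma+(1-\theta)\alpha_3$, $\frac nq+\alpha_1=\theta(n+\alpha_2-1)+(\frac nu+\alpha_3)(1-\theta)$ and $\frac1r=\frac\theta s+\frac{1-\theta}v$. Then there is $c>0$ such that $$\|f\|_{\dot K_q^{\alpha_1,r}(\mathbb{R}^n)}\le c\,\|\nabla f\|_{\dot K_1^{\alpha_2,s}(\mathbb{R}^n)}^{\theta}\,\|f\|_{\dot K_u^{\alpha_3,v}(\mathbb{R}^n)}^{1-\theta}\quad\text{for all } f\in C^1(\mathbb{R}^n).$$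
   Context: For $k\in\mathbb{Z}$ let $C_k=\{x\in\mathbb{R}^n: 2^{k-1}\le |x|<2^k\}$ and $\chi_k$ its characteristic function. For $\alpha\in\mathbb{R}$ and $0<p,q\le\infty$, $\|f\|_{\dot K_p^{\alpha,q}(\mathbb{R}^n)}=\big(\sum_{k\in\mathbb{Z}}2^{k\alpha q}\|f\chi_k\|_{L^p}^q\big)^{1/q}$ (usual modification if $q=\infty$); for the gradient, $\|\nabla f\|_{\dot K_p^{\alpha,q}}$ means $\||\nabla f|\|_{\dot K_p^{\alpha,q}}$.
   Formalization: The inequality is proved for those f in C^1(R^n) for which both norms on the right-hand side are finite; without this it fails or reads 0·∞, e.g. for a nonzero constant f, whose gradient norm is 0 while its own Herz norms are infinite. *)

(* Defs.v *)
From HB Require Import structures.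
From mathcomp Require Import all_boot all_order all_algebra.
From mathcomp Require Import all_classical all_reals all_analysis.
Set Implicit Arguments. Unset Strict Implicit. Unset Printing Implicit Defensive.
Import Order.TTheory GRing.Theory Num.Theory.
Import numFieldNormedType.Exports.
Local Open Scope classical_set_scope.
Local Open Scope ring_scope.

Section Herz.
Variable R : realType.

Definition eucl (n : nat) (x : 'rV[R]_n) : R := Num.sqrt (\sum_(i < n) x 0 i ^+ 2).

Definition shell (n : nat) (k : int) : set 'rV[R]_n :=
  [set x | (2 `^ (k%:~R - 1) <= eucl x) && (eucl x < 2 `^ k%:~R)].

(* Lebesgue integral on R^n of a (nonnegative) function, as the iterated
   Lebesgue integral over the coordinates (Tonelli). *)
Fixpoint iint (n : nat) : ('rV[R]_n -> \bar R) -> \bar R :=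
  match n with
  | 0 => fun g => g 0
  | m.+1 => fun g => (\int[@lebesgue_measure R]_x
                       iint (fun t : 'rV[R]_m => g (row_mx (\row_(j < 1) x) t)))%E
  end.

Definition Lpnorm (n : nat) (p : R) (g : 'rV[R]_n -> R) : \bar R :=
  ((iint (fun x => (`|g x| `^ p)%:E)) `^ p^-1)%E.

Definition restr (n : nat) (k : int) (g : 'rV[R]_n -> R) : 'rV[R]_n -> R :=
  fun x => if `[< shell k x >] then g x else 0.

Definition herz_norm (n : nat) (alpha p q : R) (g : 'rV[R]_n -> R) : \bar R :=
  ((\esum_(k in [set: int]) ((2 `^ (k%:~R * alpha * q))%:E * (Lpnorm p (restr k g)) `^ q))
     `^ q^-1)%E.

Definition evec (n : nat) (i : 'I_n) : 'rV[R]_n := \row_(j < n) (i == j)%:R.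
Definition partial (n : nat) (i : 'I_n) (f : 'rV[R]_n -> R) (x : 'rV[R]_n) : R :=
  'D_(evec i) f x.

Definition grad_norm (n : nat) (f : 'rV[R]_n -> R) (x : 'rV[R]_n) : R :=
  Num.sqrt (\sum_(i < n) partial i f x ^+ 2).

Definition C1 (n : nat) (f : 'rV[R]_n -> R) : Prop :=
  (forall x, differentiable f x) /\ (forall i : 'I_n, continuous (partial i f)).

End Herz.

(* Main.v *)
Require Import Defs.
From HB Require Import structures.
From mathcomp Require Import all_boot all_order all_algebra.
From mathcomp Require Import all_classical all_reals all_analysis.
From mathcomp Require Import measurable_realfun ring lra.
Set Implicit Arguments. Unset Strict Implicit. Unset Printing Implicit Defensive.
Import Order.TTheory GRing.Theory Num.Theory.
Import numFieldNormedType.Exports.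
Local Open Scope classical_set_scope.
Local Open Scope ring_scope.

(* Let [C_k] be the shell of radii [2^(k-1), 2^k], put [d = alpha2 - sigma] and
   [w = f - f(2 .)].  Along a segment of length [L = 2^(k-2)] parallel to a
   coordinate axis and issued from a point of [C_k], one stays in the neighbouring
   shells, so [|w|] on [C_k] is bounded by every line integral of [|grad w| + |w| / L].
   The Gagliardo-Loomis-Whitney argument, run together with Hoelder's inequality,
   then bounds the [L^q] norm of [w] on [C_k] by
   [2^(k d theta) (int |grad f|)^theta (int |f|^u)^((1 - theta) / u)], the integrals
   being taken over a few neighbouring shells; here [int |w|] is controlled by
   [int |grad f|] by integrating [grad f] along rays.  Rescaling [f(2 .)] shows
   that [M_k = 2^(k alpha1) ||f||_{L^q(C_k)}] satisfies, with [gamma = n/q + alpha1 > 0],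
   [M_k <= 2^(- gamma) M_{k+1} + error_k] up to a factor as close to [1] as desired.
   As the second norm of [f] is finite and [n/u + alpha3 > 0], [M_k] grows too slowly
   for the iterated first term to survive, hence [M] is bounded in [l^r] by the errors,
   and these are summed by the discrete Hoelder inequality. *)

(** * Weighted Hoelder inequality for several functions *)

(** The line estimate costs a term [|w| / L], and for [f] itself no multiple of the gradient pays
    for it, as constants show. The difference [w] kills constants, and its integral over an annulus
    is at most the radius times that of the gradient, up to a factor. The price is the recursion:
    constants have [M_k] proportional to 2^(k gamma), exactly its homogeneous solution, so only the
    second norm can exclude them. The needed a priori growth bound comes from the same annulus
    inequality applied to [f], the leftover integral of [|f|] being bounded through that of [|f|^u].
    In the annulus inequality [|w|^q] is split as [|w|^(q theta d)] times
    [(|w|^u)^(q (1 - theta) / u)] times [|w|^(q theta (1 - d))]; the last factor is shared equally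
    among the line integrals in the coordinate directions. Hoelder requires nonnegative weights,
    whence [0 <= d <= 1], that is [sigma <= alpha2 <= sigma + 1], and weights of sum 1, which is
    what remains of the two equations for [alpha1] once [alpha1] is eliminated. *)

Section hoelder.
Local Open Scope ereal_scope.
Context {R : realType}.
Implicit Types (a b : R).

Lemma poweR_young (x y : \bar R) a b : 0 <= x -> 0 <= y -> (0 < a)%R -> (0 < b)%R ->
  (a + b = 1)%R -> x `^ a * y `^ b <= a%:E * x + b%:E * y.
Proof.
move=> x0 y0 a0 b0 ab.
have [->|xoo] := eqVneq x +oo.
  by rewrite gt0_muley ?lte_fin// addye ?leey// gt_eqF// (lt_le_trans (ltNyr 0%R))// mule_ge0// lee_fin ltW.
have [->|yoo] := eqVneq y +oo.
  by rewrite [X in _ + X]gt0_muley ?lte_fin// addey ?leey// gt_eqF// (lt_le_trans (ltNyr 0%R))// mule_ge0// lee_fin ltW.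
have xf : x \is a fin_num by rewrite ge0_fin_numE// ltey.
have yf : y \is a fin_num by rewrite ge0_fin_numE// ltey.
rewrite -(fineK xf) -(fineK yf) !poweR_EFin -!EFinM -EFinD lee_fin.
have := @conjugate_powR R (fine x `^ a)%R (fine y `^ b)%R a^-1%R b^-1%R
  (powR_ge0 _ _) (powR_ge0 _ _).
rewrite !invr_gt0 !invrK => /(_ a0 b0 ab).
rewrite -!powRrM !mulfV ?gt_eqF// !powRr1 ?fine_ge0//.
by rewrite [(fine x * a)%R]mulrC [(fine y * b)%R]mulrC.
Qed.

(** Young's inequality for [x / I] and [y / J]. With the two integrals (or sums) as [I] and [J],
    integrating (or summing) it gives Hoelder's inequality at once. *)
Lemma poweR_young_scaled (x y : \bar R) (a b I J : R) : 0 <= x -> 0 <= y ->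
  (0 < a)%R -> (0 < b)%R -> (a + b = 1)%R -> (0 < I)%R -> (0 < J)%R ->
  x `^ a * y `^ b <= (I `^ a * J `^ b * (a / I))%R%:E * x +
                     (I `^ a * J `^ b * (b / J))%R%:E * y.
Proof.
move=> x0 y0 a0 b0 ab I0 J0.
have IJ0 : (0 <= I `^ a * J `^ b)%R by rewrite mulr_ge0// powR_ge0.
have Ix : 0 <= I^-1%:E * x by rewrite mule_ge0// lee_fin invr_ge0 ltW.
have Jy : 0 <= J^-1%:E * y by rewrite mule_ge0// lee_fin invr_ge0 ltW.
have := poweR_young Ix Jy a0 b0 ab.
move/(@lee_wpmul2l _ (I `^ a * J `^ b)%:E).
rewrite lee_fin => /(_ IJ0).
rewrite !poweRM// ?lee_fin ?invr_ge0 ?(ltW I0) ?(ltW J0)//.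
have -> : (I `^ a * J `^ b)%:E * (I^-1%:E `^ a * x `^ a * (J^-1%:E `^ b * y `^ b))
   = x `^ a * y `^ b.
  rewrite muleACA !poweR_EFin [LHS]muleA -!EFinM.
  have -> : (I `^ a * J `^ b * (I^-1 `^ a * J^-1 `^ b) = 1)%R.
    rewrite mulrACA -!powRM ?invr_ge0 ?ltW//.
    by rewrite !mulfV ?gt_eqF// !powR1 mulr1.
  by rewrite mul1e.
move=> h; apply: (le_trans h).
rewrite ge0_muleDr ?mule_ge0 ?lee_fin ?invr_ge0 ?(ltW a0) ?(ltW b0) ?(ltW I0) ?(ltW J0)//.
by rewrite !muleA -!EFinM !mulrA.
Qed.

Context d (T : measurableType d) (mu : {measure set T -> \bar R}).

Lemma measurable_fun_poweR (D : set T) (f : T -> \bar R) a :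
  measurable_fun D f -> measurable_fun D (fun t => f t `^ a).
Proof. by move=> mf; apply: (@measurableT_comp _ _ _ _ _ _ (poweR ^~ a)) mf; exact: measurable_poweR. Qed.

Let hoelder_null (f g : T -> \bar R) a b :
  measurable_fun setT f -> measurable_fun setT g ->
  (forall x, 0 <= f x) -> (0 < a)%R -> \int[mu]_x f x = 0 ->
  \int[mu]_x (f x `^ a * g x `^ b) = 0.
Proof.
move=> mf mg f0 a0 If0.
have : \int[mu]_x `|f x| = 0.
  by rewrite -[RHS]If0; apply: eq_integral => x _; rewrite gee0_abs.
move/(ae_eq_integral_abs mu measurableT mf).1 => fae.
transitivity (\int[mu]_x (cst 0 x : \bar R)); last by rewrite integral0.
apply: ge0_ae_eq_integral => //.
- by apply: emeasurable_funM; exact: measurable_fun_poweR.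
- by move=> x _; rewrite mule_ge0 ?poweR_ge0.
- apply: filterS fae => x /= /(_ I) ->.
  by rewrite poweR0r ?gt_eqF// mul0e.
Qed.

Lemma hoelder_pair (f g : T -> \bar R) a b :
  measurable_fun setT f -> measurable_fun setT g ->
  (forall x, 0 <= f x) -> (forall x, 0 <= g x) ->
  (0 <= a)%R -> (0 <= b)%R -> (a + b = 1)%R ->
  \int[mu]_x (f x `^ a * g x `^ b)
    <= (\int[mu]_x f x) `^ a * (\int[mu]_x g x) `^ b.
Proof.
move=> mf mg f0 g0.
rewrite le_eqVlt => /predU1P[<- _|a0].
  rewrite add0r => ->; rewrite poweRe0 mul1e poweRe1; last exact: integral_ge0.
  apply: ge0_le_integral => //.
  - by move=> x _; rewrite poweRe0 mul1e poweR_ge0.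
  - by apply: emeasurable_funM; exact: measurable_fun_poweR.
  - by move=> x _; rewrite poweRe0 mul1e poweRe1.
rewrite le_eqVlt => /predU1P[<-|b0].
  rewrite addr0 => ->; rewrite poweRe0 mule1 poweRe1; last exact: integral_ge0.
  apply: ge0_le_integral => //.
  - by move=> x _; rewrite poweRe0 mule1 poweR_ge0.
  - by apply: emeasurable_funM; exact: measurable_fun_poweR.
  - by move=> x _; rewrite poweRe0 mule1 poweRe1.
move=> ab.
have If0 : 0 <= \int[mu]_x f x by exact: integral_ge0.
have Ig0 : 0 <= \int[mu]_x g x by exact: integral_ge0.
(* Null integrals come before infinite ones: the right side may be [0 * +oo = 0], so the left side
   has to be shown null. *)
have [If|If] := eqVneq (\int[mu]_x f x) 0.
  by rewrite hoelder_null// mule_ge0// poweR_ge0.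
have [Ig|Ig] := eqVneq (\int[mu]_x g x) 0.
  under eq_integral do rewrite muleC.
  by rewrite hoelder_null// mule_ge0// poweR_ge0.
have [Ify|Ify] := eqVneq (\int[mu]_x f x) +oo.
  by rewrite Ify poweRyr ?gt_eqF// gt0_mulye ?leey// poweR_gt0// lt_def Ig.
have [Igy|Igy] := eqVneq (\int[mu]_x g x) +oo.
  by rewrite Igy poweRyr ?gt_eqF// gt0_muley ?leey// poweR_gt0// lt_def If.
have Iff : \int[mu]_x f x \is a fin_num by rewrite ge0_fin_numE// ltey.
have Igf : \int[mu]_x g x \is a fin_num by rewrite ge0_fin_numE// ltey.
rewrite -(fineK Iff) -(fineK Igf).
set I := fine (\int[mu]_x f x); set J := fine (\int[mu]_x g x).
have I0 : (0 < I)%R by rewrite fine_gt0// lt_def If If0 ltey.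
have J0 : (0 < J)%R by rewrite fine_gt0// lt_def Ig Ig0 ltey.
have IJ0 : (0 <= I `^ a * J `^ b)%R by rewrite mulr_ge0// powR_ge0.
rewrite !poweR_EFin -EFinM.
pose k1 := (I `^ a * J `^ b * (a / I))%R.
pose k2 := (I `^ a * J `^ b * (b / J))%R.
have k10 : (0 <= k1)%R by rewrite mulr_ge0// divr_ge0// ltW.
have k20 : (0 <= k2)%R by rewrite mulr_ge0// divr_ge0// ltW.
apply: (@le_trans _ _ (\int[mu]_x (k1%:E * f x + k2%:E * g x))).
  apply: ge0_le_integral => //.
  - by move=> x _; rewrite mule_ge0 ?poweR_ge0.
  - by apply: emeasurable_funM; exact: measurable_fun_poweR.
  - by apply: emeasurable_funD; exact: measurable_funeM.
  by move=> x _; exact: poweR_young_scaled.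
rewrite ge0_integralD//; last 4 first.
- by move=> x _; rewrite mule_ge0.
- exact: measurable_funeM.
- by move=> x _; rewrite mule_ge0.
- exact: measurable_funeM.
rewrite !ge0_integralZl_EFin// -(fineK Iff) -(fineK Igf) -/I -/J -!EFinM -EFinD.
rewrite lee_fin /k1 /k2 -!mulrA !mulVf ?gt_eqF// !mulr1.
by rewrite !mulrA -mulrDr ab mulr1.
Qed.

Lemma prode_ge0 (I : Type) (s : seq I) (h : I -> \bar R) :
  (forall i, 0 <= h i) -> 0 <= \big[mule/1]_(i <- s) h i.
Proof. by move=> h0; apply: (big_ind (fun x => 0 <= x)) => // x y; exact: mule_ge0. Qed.

Lemma poweR_prod (I : Type) (s : seq I) (h : I -> \bar R) a :
  (forall i, 0 <= h i) ->
  (\big[mule/1]_(i <- s) h i) `^ a = \big[mule/1]_(i <- s) (h i) `^ a.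
Proof.
move=> h0; elim: s => [|i s IH]; first by rewrite !big_nil poweR1r.
by rewrite !big_cons poweRM ?IH// prode_ge0.
Qed.

Lemma emeasurable_prod (I : Type) (s : seq I) (h : I -> T -> \bar R) :
  (forall i, measurable_fun setT (h i)) ->
  measurable_fun setT (fun x => \big[mule/1]_(i <- s) h i x).
Proof.
move=> mh; elim: s => [|i s IH].
  by rewrite (_ : (fun _ => _) = cst 1)//; apply/funext => x; rewrite big_nil.
by under eq_fun do rewrite big_cons; apply: emeasurable_funM.
Qed.

(** Induction on the list: the tail is [G] to the power [W], its total weight, where [G] has the
    weights [w j / W] of sum 1; [hoelder_pair] separates the head from [G]. If [W = 0] all tail
    factors are 1. *)
Lemma hoelder_seq (I : Type) (s : seq I) (f : I -> T -> \bar R) (w : I -> R) :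
  (forall i, measurable_fun setT (f i)) -> (forall i x, 0 <= f i x) ->
  (forall i, 0 <= w i)%R -> (\sum_(i <- s) w i = 1)%R ->
  \int[mu]_x (\big[mule/1]_(i <- s) f i x `^ w i)
    <= \big[mule/1]_(i <- s) (\int[mu]_x f i x) `^ w i.
Proof.
move=> mf f0; elim: s w => [|i s IH] w w0.
  by rewrite big_nil => /eqP; rewrite eq_sym oner_eq0.
rewrite big_cons => wi; under eq_integral do rewrite big_cons.
rewrite big_cons.
set W := (\sum_(j <- s) w j)%R in wi.
have W0 : (0 <= W)%R by exact: sumr_ge0.
have [WE|WN] := eqVneq W 0%R.
  have {}wi : w i = 1%R by rewrite -wi WE addr0.
  have H (g : I -> \bar R) : \big[mule/1]_(j <- s) (g j) `^ w j = 1.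
    move: WE; rewrite /W; elim: s {IH W wi W0} => [|j s IH]; first by rewrite !big_nil.
    rewrite !big_cons => /eqP; rewrite paddr_eq0 ?sumr_ge0// => /andP[/eqP -> /eqP/IH->].
    by rewrite poweRe0 mule1.
  rewrite H mule1 wi poweRe1 ?integral_ge0//.
  by under eq_integral do rewrite H mule1 poweRe1//.
pose G x := \big[mule/1]_(j <- s) f j x `^ (w j / W).
have GE x : \big[mule/1]_(j <- s) f j x `^ w j = G x `^ W.
  rewrite /G poweR_prod => [|j]; last exact: poweR_ge0.
  by apply: eq_bigr => j _; rewrite -poweRrM divfK.
under eq_integral do rewrite GE.
have mG : measurable_fun setT G.
  by apply: emeasurable_prod => j; exact: measurable_fun_poweR.
have G0 x : 0 <= G x by apply: prode_ge0 => j; exact: poweR_ge0.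
apply: (le_trans (hoelder_pair (mf i) mG (f0 i) G0 (w0 i) W0 wi)).
apply: lee_wpmul2l; first exact: poweR_ge0.
have -> : \big[mule/1]_(j <- s) (\int[mu]_x f j x) `^ w j =
   (\big[mule/1]_(j <- s) (\int[mu]_x f j x) `^ (w j / W)) `^ W.
  rewrite poweR_prod => [|j]; last exact: poweR_ge0.
  by apply: eq_bigr => j _; rewrite -poweRrM divfK.
apply: gt0_ler_poweR => //.
- by rewrite in_itv /= leey andbT integral_ge0.
- by rewrite in_itv /= leey andbT; apply: prode_ge0 => j; exact: poweR_ge0.
apply: IH => [j|]; first by rewrite divr_ge0.
by rewrite -mulr_suml mulfV.
Qed.

End hoelder.

(** * Iterated integrals *)

Section iterated_integral.
Local Open Scope ereal_scope.
Context {R : realType}.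
Local Notation mu := (@lebesgue_measure R).
Local Notation TR := (measurableTypeR R).

(** The very term occurring in [iint], so that an unfolded iterated integral shows [hcons] up to
    conversion. *)
Definition hcons m (x : R) (t : 'rV[R]_m) : 'rV[R]_m.+1 := row_mx (\row_(j < 1) x) t.

Lemma hcons0 m x (t : 'rV[R]_m) : hcons x t 0%R ord0 = x.
Proof.
have -> : ord0 = lshift m (@ord0 0) :> 'I_(1 + m) by exact/val_inj.
by apply: etrans (row_mxEl _ _ _ _) _; rewrite mxE.
Qed.

Lemma hconsS m x (t : 'rV[R]_m) j : hcons x t 0%R (lift ord0 j) = t 0%R j.
Proof.
have -> : lift ord0 j = rshift 1 j :> 'I_(1 + m) by exact/val_inj.
exact: row_mxEr.
Qed.

Lemma hcons_row m x (c : 'I_m -> R) :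
  hcons x (\row_i c i) = \row_i (if unlift ord0 i is Some j then c j else x).
Proof.
apply/rowP => i; rewrite [RHS]mxE; case: unliftP => [j ->|->].
  by rewrite hconsS mxE.
by rewrite hcons0.
Qed.

(* Joint measurability in a parameter and a row vector, tested on measurable
   families of coordinates: this is measurability for the product sigma-algebra
   without having to put one on ['rV_n]. *)
Definition jmeas d (P : measurableType d) dU (U : measurableType dU) n
    (g : P -> 'rV[R]_n -> U) : Prop :=
  forall d' (Q : measurableType d') (p : Q -> P) (c : 'I_n -> Q -> R),
    measurable_fun setT p -> (forall i, measurable_fun setT (c i)) ->
    measurable_fun setT (fun z => g (p z) (\row_i c i z)).

Definition rmeas dU (U : measurableType dU) n (g : 'rV[R]_n -> U) : Prop :=
  forall d' (Q : measurableType d') (c : 'I_n -> Q -> R),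
    (forall i, measurable_fun setT (c i)) ->
    measurable_fun setT (fun z => g (\row_i c i z)).

Section jmeas_theory.
Context d (P : measurableType d) dU (U : measurableType dU).

Lemma jmeas_rmeas n (g : P -> 'rV[R]_n -> U) p : jmeas g -> rmeas (g p).
Proof. by move=> mg d' Q c mc; apply: (mg _ _ (cst p) c). Qed.

Lemma rmeas_hcons n (g : 'rV[R]_n.+1 -> U) : rmeas g ->
  jmeas (fun (x : TR) t => g (hcons x t)).
Proof.
move=> mg d' Q p c mp mc.
under eq_fun do rewrite hcons_row.
apply: (mg _ _ (fun i z => if unlift ord0 i is Some j then c j z else p z)) => i.
by case: (unlift ord0 i).
Qed.

Lemma jmeas_hcons n (g : P -> 'rV[R]_n.+1 -> U) : jmeas g ->
  jmeas (fun (z : P * TR) t => g z.1 (hcons z.2 t)).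
Proof.
move=> mg d' Q p c mp mc.
under eq_fun do rewrite hcons_row.
apply: (mg _ _ (fst \o p)
  (fun i z => if unlift ord0 i is Some j then c j z else (snd \o p) z)) => [|i].
  by apply: measurableT_comp.
by case: (unlift ord0 i) => [j|]; [exact: mc|exact: (measurableT_comp measurable_snd mp)].
Qed.

Lemma jmeas_measurable n (g : P -> 'rV[R]_n -> U) t : jmeas g ->
  measurable_fun setT (fun p => g p t).
Proof.
move=> mg; have -> : (fun p => g p t) = (fun p => g (id p) (\row_i cst (t 0%R i) p)).
  by apply/funext => p; congr g; apply/rowP => i; rewrite mxE.
exact: mg.
Qed.

End jmeas_theory.

Lemma iint_ge0 n (g : 'rV[R]_n -> \bar R) : (forall x, 0 <= g x) -> 0 <= iint g.
Proof.
elim: n g => [|n IH] g g0 /=; first exact: g0.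
by apply: integral_ge0 => x _; exact: IH.
Qed.

(** The parameter space is universally quantified because the induction enlarges it: the first
    coordinate becomes a parameter in [P * TR], and Tonelli then integrates it out. *)
Lemma jmeas_iint n d (P : measurableType d) (g : P -> 'rV[R]_n -> \bar R) :
  jmeas g -> (forall p x, 0 <= g p x) -> measurable_fun setT (fun p => iint (g p)).
Proof.
elim: n d P g => [|n IH] d P g mg g0 /=; first exact: jmeas_measurable.
have mh : measurable_fun setT (fun z : P * TR => iint (fun t => g z.1 (hcons z.2 t))).
  by apply: IH => //; exact: jmeas_hcons.
apply: (@measurable_fun_fubini_tonelli_F _ _ P TR R mu _ mh) => z.
exact: iint_ge0.
Qed.

Lemma measurable_iint_hcons n (g : 'rV[R]_n.+1 -> \bar R) :
  rmeas g -> (forall x, 0 <= g x) ->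
  measurable_fun setT (fun x : TR => iint (fun t => g (hcons x t))).
Proof. by move=> mg g0; apply: jmeas_iint => //; exact: rmeas_hcons. Qed.

Lemma rmeas_slice dU (U : measurableType dU) n (g : 'rV[R]_n.+1 -> U) x :
  rmeas g -> rmeas (fun t => g (hcons x t)).
Proof. by move=> /rmeas_hcons mg; apply: (jmeas_rmeas (g := fun (x : TR) t => g (hcons x t))). Qed.

Lemma le_iint n (g h : 'rV[R]_n -> \bar R) : rmeas g -> rmeas h ->
  (forall x, 0 <= g x) -> (forall x, g x <= h x) -> iint g <= iint h.
Proof.
elim: n g h => [|n IH] g h mg mh g0 gh /=; first exact: gh.
have h0 x : 0 <= h x by exact: le_trans (gh x).
apply: ge0_le_integral => //.
- by move=> x _; exact: iint_ge0.
- exact: measurable_iint_hcons.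
- exact: measurable_iint_hcons.
- by move=> x _; apply: IH => //; exact: rmeas_slice.
Qed.

Lemma eq_iint n (g h : 'rV[R]_n -> \bar R) : (forall x, g x = h x) -> iint g = iint h.
Proof. by move=> gh; congr iint; exact/funext. Qed.

Lemma iintD n (g h : 'rV[R]_n -> \bar R) : rmeas g -> rmeas h ->
  (forall x, 0 <= g x) -> (forall x, 0 <= h x) ->
  iint (fun x => g x + h x) = iint g + iint h.
Proof.
elim: n g h => [//|n IH] g h mg mh g0 h0 /=.
rewrite -ge0_integralD//.
- by apply: eq_integral => x _; rewrite IH//; exact: rmeas_slice.
- by move=> x _; exact: iint_ge0.
- exact: measurable_iint_hcons.
- by move=> x _; exact: iint_ge0.
- exact: measurable_iint_hcons.
Qed.

Lemma iintZl n (g : 'rV[R]_n -> \bar R) (k : R) : rmeas g ->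
  (forall x, 0 <= g x) -> (0 <= k)%R ->
  iint (fun x => k%:E * g x) = k%:E * iint g.
Proof.
elim: n g => [//|n IH] g mg g0 k0 /=.
rewrite -ge0_integralZl_EFin//.
- by apply: eq_integral => x _; rewrite IH//; exact: rmeas_slice.
- by move=> x _; exact: iint_ge0.
- exact: measurable_iint_hcons.
Qed.

Lemma iint_cst0 n : iint (fun _ : 'rV[R]_n => 0) = 0 :> \bar R.
Proof. by elim: n => [//|n IH] /=; under eq_integral do rewrite IH; rewrite integral0. Qed.

(** Tonelli in the plane exchanges [y] with the first coordinate; for each fixed value of the latter
    the induction hypothesis handles the others. *)
Lemma iint_tonelli n (g : TR -> 'rV[R]_n -> \bar R) : jmeas g ->
  (forall y x, 0 <= g y x) ->
  \int[mu]_y iint (g y) = iint (fun x => \int[mu]_y g y x).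
Proof.
elim: n g => [//|n IH] g mg g0 /=.
have mh : measurable_fun setT (fun z : TR * TR => iint (fun t => g z.1 (hcons z.2 t))).
  by apply: jmeas_iint => //; exact: jmeas_hcons.
have := @fubini_tonelli _ _ TR TR R mu mu _ mh.
move=> -> /=; last by move=> z; exact: iint_ge0.
apply: eq_integral => x _; rewrite IH// => d' Q p c mp mc.
apply: (jmeas_hcons mg (p := fun z => (p z, x))) => //.
exact: measurable_fun_pair.
Qed.

Lemma measurable_fun_integral d (Q : measurableType d) (h : Q -> TR -> \bar R) :
  measurable_fun setT (fun z : Q * TR => h z.1 z.2) -> (forall q y, 0 <= h q y) ->
  measurable_fun setT (fun q => \int[mu]_y h q y).
Proof.
move=> mh h0.
by apply: (@measurable_fun_fubini_tonelli_F _ _ Q TR R mu _ mh).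
Qed.

Lemma rmeas_integral n (g : TR -> 'rV[R]_n -> \bar R) :
  jmeas g -> (forall z x, 0 <= g z x) -> rmeas (fun x => \int[mu]_y g y x).
Proof.
move=> mg g0 d' Q c mc.
apply: (@measurable_fun_integral _ Q (fun z y => g y (\row_i c i z))) => //.
apply: (mg _ _ (fun z : Q * TR => z.2) (fun i z => c i z.1)) => [|i].
  exact: measurable_snd.
by apply: (measurableT_comp (mc i)).
Qed.

(** The image of Lebesgue measure under multiplication by [a], multiplied by [a], gives half-open
    intervals their length, hence is Lebesgue measure by uniqueness. *)
Lemma integral_scale (g : TR -> \bar R) (a : R) : (0 < a)%R ->
  measurable_fun setT g -> (forall x, 0 <= g x) ->
  \int[mu]_x g (a * x)%R = (a^-1)%:E * \int[mu]_x g x.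
Proof.
move=> a0 mg g0.
have ma : measurable_fun setT (fun x : TR => (a * x)%R : TR) by exact: mulrl_measurable.
have ai0 : (0 <= a^-1)%R by rewrite invr_ge0 ltW.
rewrite -[X in \int[mu]_(x in X) _](preimage_setT (fun x : TR => (a * x)%R : TR)).
rewrite -(@ge0_integral_pushforward _ _ TR TR R (fun x : TR => (a * x)%R : TR) ma mu setT g)//.
rewrite -(ge0_integral_mscale mu measurableT (NngNum ai0))//.
apply: eq_measure_integral => A mA _.
have a1 : a != 0%R by rewrite gt_eqF.
pose nu := mscale (NngNum (ltW a0)) (pushforward mu (fun x : TR => (a * x)%R : TR)).
have nuE : mu A = (a%:E * pushforward mu (fun x : TR => (a * x)%R : TR) A).
  rewrite (_ : a%:E * _ = nu ma A)//.
  apply: (@lebesgue_measure_unique R (nu ma)) => //= _ [[x y]] _ <-.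
  rewrite /nu /mscale /= /pushforward.
  have -> : (fun t : TR => (a * t)%R : TR) @^-1` `]x, y] = `](x / a)%R, (y / a)%R]%classic.
    apply/seteqP; split => t /=; rewrite !in_itv/= => /andP[xt ty]; apply/andP.
      by rewrite ltr_pdivrMr// ler_pdivlMr// mulrC.
    by rewrite mulrC -ltr_pdivrMr// -ler_pdivlMr.
  rewrite !lebesgue_measure_itv/= !lte_fin ltr_pM2r ?invr_gt0//.
  case: ifP => _; last by rewrite mule0.
  by rewrite -EFinB -EFinM -mulrBl mulrC divfK.
transitivity ((a^-1)%:E * mu A); last by [].
by rewrite nuE muleA -EFinM mulVf// mul1e.
Qed.

Lemma hconsZ m (a x : R) (t : 'rV[R]_m) : a *: hcons x t = hcons (a * x) (a *: t).
Proof.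
apply/rowP => i; rewrite mxE; case: (unliftP ord0 i) => [j ->|->].
  by rewrite !hconsS mxE.
by rewrite !hcons0.
Qed.

Lemma scale_row m (a : R) (c : 'I_m -> R) : a *: (\row_i c i) = \row_i (a * c i)%R.
Proof. by apply/rowP => i; rewrite !mxE. Qed.

Lemma rmeas_scale dU (U : measurableType dU) n (g : 'rV[R]_n -> U) (a : R) :
  rmeas g -> rmeas (fun x => g (a *: x)).
Proof.
move=> mg d Q c mc; under eq_fun do rewrite scale_row.
apply: (mg _ _ (fun i z => a * c i z)%R) => i.
by apply: measurable_funM.
Qed.

Lemma jmeas_scale dU (U : measurableType dU) n (g : 'rV[R]_n -> U) :
  rmeas g -> jmeas (fun (a : TR) x => g (a *: x)).
Proof.
move=> mg d Q p c mp mc; under eq_fun do rewrite scale_row.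
apply: (mg _ _ (fun i z => p z * c i z)%R) => i.
by apply: measurable_funM.
Qed.

Lemma iint_scale n (g : 'rV[R]_n -> \bar R) (a : R) : (0 < a)%R -> rmeas g ->
  (forall x, 0 <= g x) ->
  iint (fun x => g (a *: x)) = (a ^- n)%:E * iint g.
Proof.
elim: n g => [|n IH] g a0 mg g0.
  by rewrite /= scaler0 expr0 invr1 mul1e.
rewrite exprS invfM mulrC EFinM -muleA /=.
rewrite -integral_scale//; last 2 first.
- exact: measurable_iint_hcons.
- by move=> x; exact: iint_ge0.
rewrite -ge0_integralZl_EFin//; last 3 first.
- by move=> x _; exact: iint_ge0.
- apply: (measurableT_comp (measurable_iint_hcons mg g0)).
  exact: mulrl_measurable.
- by rewrite invr_ge0 exprn_ge0// ltW.
apply: eq_integral => x _.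
rewrite -IH//; last exact: rmeas_slice.
by apply: eq_iint => t; rewrite -/(hcons x t) hconsZ.
Qed.

End iterated_integral.

(** * Gagliardo-Loomis-Whitney inequality *)

Section gagliardo.
Local Open Scope ereal_scope.
Context {R : realType}.
Local Notation mu := (@lebesgue_measure R).
Local Notation TR := (measurableTypeR R).

(** The open set [U] is the union of the countably many rational boxes that it contains, and a box
    pulls back to a finite intersection of measurable sets. *)
Lemma rmeas_continuous n (f : 'rV[R]_n -> R) : continuous f -> rmeas f.
Proof.
move=> cf d Q c mc _; apply: (measurability _ (RGenOInfty.measurableE R)) => //.
move=> /= _ [_ [a ->] <-]; apply: measurableI => //.
pose U := f @^-1` `]a, +oo[%classic.
pose box (k : nat * {ffun 'I_n -> rat}) : set 'rV[R]_n :=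
  [set x | forall i, `|x 0%R i - ratr (k.2 i)|%R < k.1.+1%:R^-1]%R.
rewrite (_ : _ @^-1` _ = \bigcup_k (if `[< box k `<=` U >] then
    \bigcap_i [set z | `|c i z - ratr (k.2 i)|%R < k.1.+1%:R^-1]%R else set0)).
  apply: countable_bigcupT_measurable; first exact: countableP.
  move=> k; case: ifP => // _.
  apply: fin_bigcap_measurable => // i _.
  rewrite -[X in measurable X]setTI.
  have : measurable_fun setT (fun z => `|c i z - ratr (k.2 i)| < k.1.+1%:R^-1)%R.
    apply: measurable_fun_ltr => //.
    by apply: measurableT_comp => //; exact: measurable_funB.
  by move=> /(_ measurableT [set true]); apply.
have Uo : open U.
  by apply: (open_comp (fun x _ => cf x)); exact: interval_open.
apply/seteqP; split => z /=.
  move=> zU; have : U (\row_i c i z) by [].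
  move=> zU'.
  have /nbhs_ballP[e /= e0 eU] : nbhs (\row_i c i z) U by exact: (open_nbhs_nbhs (conj Uo zU')).
  (* Two points of a box of radius [1 / k.+1] differ by less than [2 / k.+1] in each coordinate,
     which has to stay under [e]. *)
  pose k := Num.truncn (2 / e)%R.
  have ke : (2 / k.+1%:R < e)%R.
    by rewrite ltr_pdivrMr// mulrC -ltr_pdivrMr// real_truncnS_gt ?num_real.
  have h i : exists q : rat, (`|c i z - ratr q| < k.+1%:R^-1)%R.
    have : (c i z - k.+1%:R^-1 < c i z)%R by rewrite ltrBlDr ltrDl invr_gt0.
    move=> /rat_in_itvoo[q]; rewrite in_itv/= => /andP[q1 q2]; exists q.
    by rewrite ger0_norm ?subr_ge0 ?ltW// ltrBlDr -ltrBlDl.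
  pose b := [ffun i => projT1 (cid (h i))].
  exists (k, b) => //.
  case: asboolP => [_ i _|] /=; first by rewrite ffunE; case: cid.
  apply: contra_notP => _ y yb; apply: eU; split => // i0 i.
  rewrite ord1 !mxE /ball/= -(subrKA (ratr (b i))).
  rewrite (le_lt_trans (ler_normD _ _))// (lt_trans _ ke)//.
  have := yb i; rewrite /= distrC => y1.
  have : (`|c i z - ratr (b i)| < k.+1%:R^-1)%R by rewrite ffunE; case: cid.
  move=> y2; rewrite -[2%R]/(1 + 1)%R mulrDl mul1r ltrD//.
move=> [k _]; case: asboolP => // kU /= zk.
by apply: kU => i; rewrite mxE; exact: zk.
Qed.

Definition upd n (x : 'rV[R]_n) (i : 'I_n) (y : R) : 'rV[R]_n :=
  \row_j (if j == i then y else x 0%R j).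

Lemma upd_hcons0 n x (t : 'rV[R]_n) y : upd (hcons x t) ord0 y = hcons y t.
Proof.
apply/rowP => i; rewrite mxE; case: (unliftP ord0 i) => [j ->|->].
  by rewrite !hconsS eq_sym (negbTE (neq_lift _ _)).
by rewrite eqxx hcons0.
Qed.

Lemma upd_hconsS n x (t : 'rV[R]_n) j y :
  upd (hcons x t) (lift ord0 j) y = hcons x (upd t j y).
Proof.
apply/rowP => i; rewrite mxE; case: (unliftP ord0 i) => [k ->|->].
  by rewrite !hconsS mxE (inj_eq (@lift_inj _ _)).
by rewrite (negbTE (neq_lift _ _)) !hcons0.
Qed.

(** Constant in the [i]-th coordinate of [x]: this is the structure that the Loomis-Whitney argument
    exploits. *)
Definition lineint n (i : 'I_n) (F : 'rV[R]_n -> \bar R) (x : 'rV[R]_n) : \bar R :=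
  \int[mu]_y F (upd x i y).

Lemma rmeas_lineint n i (F : 'rV[R]_n -> \bar R) :
  rmeas F -> (forall x, 0 <= F x) -> rmeas (lineint i F).
Proof.
move=> mF F0; apply: (@rmeas_integral _ _ (fun y x => F (upd x i y))) => //.
move=> d Q p c mp mc.
rewrite (_ : (fun _ => _) =
  (fun z => F (\row_j (if j == i then p z else c j z)))); last first.
  by apply/funext => z; congr F; apply/rowP => j; rewrite !mxE.
apply: (mF _ _ (fun j z => if j == i then p z else c j z)) => j.
by case: (j == i).
Qed.

Lemma rmeas_prod n (I : Type) (s : seq I) (h : I -> 'rV[R]_n -> \bar R) :
  (forall i, rmeas (h i)) -> rmeas (fun x => \big[mule/1]_(i <- s) h i x).
Proof.
by move=> mh d Q c mc; apply: emeasurable_prod => i; exact: mh.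
Qed.

Lemma rmeas_poweR n (h : 'rV[R]_n -> \bar R) (a : R) :
  rmeas h -> rmeas (fun x => h x `^ a).
Proof. by move=> mh d Q c mc; apply: measurable_fun_poweR; exact: mh. Qed.

Lemma rmeas_mule n (g h : 'rV[R]_n -> \bar R) :
  rmeas g -> rmeas h -> rmeas (fun x => g x * h x).
Proof.
by move=> mg mh d Q c mc; apply: emeasurable_funM; [exact: mg|exact: mh].
Qed.

(* Slicing off the first coordinate turns the first line integral into one more
   full function of the remaining coordinates; Hoelder is then applied in the
   first coordinate. *)
Lemma iint_prod_lineint_le n (I : Type) (s : seq I) (phi : I -> 'rV[R]_n -> \bar R)
    (w : I -> R) (F : 'I_n -> 'rV[R]_n -> \bar R) (m : R) :
  (forall i, rmeas (phi i)) -> (forall i x, 0 <= phi i x) -> (forall i, 0 <= w i)%R ->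
  (forall j, rmeas (F j)) -> (forall j x, 0 <= F j x) -> (0 <= m)%R ->
  ((0 < n)%N -> \sum_(i <- s) w i + n.-1%:R * m = 1)%R ->
  iint (fun x => (\big[mule/1]_(i <- s) phi i x `^ w i) *
                 \big[mule/1]_(j < n) lineint j (F j) x `^ m)
    <= (\big[mule/1]_(i <- s) iint (phi i) `^ w i) * \big[mule/1]_(j < n) iint (F j) `^ m.
Proof.
elim: n I s phi w F => [|n IH] I s phi w F mphi phi0 w0 mF F0 m0 wm.
  by rewrite /= !big_ord0 !mule1.
have {}wm := wm isT; rewrite /= in wm.
(* [None] indexes the new function: the first line integral, which depends on the remaining
   coordinates only. *)
pose phi' x (i : option I) t :=
  if i is Some i then phi i (hcons x t) else \int[mu]_y F ord0 (hcons y t).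
pose w' i := if i is Some i then w i else m.
pose s' := None :: map Some s.
pose F' x j t := F (lift ord0 j) (hcons x t).
pose K := iint (F ord0).
have K0 : 0 <= K by exact: iint_ge0.
pose A x i := iint (fun t => phi i (hcons x t)).
pose B x j := iint (F' x j).
have mA i : measurable_fun setT (A^~ i) by exact: measurable_iint_hcons.
have mB j : measurable_fun setT (B^~ j) by exact: measurable_iint_hcons.
have A0 x i : 0 <= A x i by exact: iint_ge0.
have B0 x j : 0 <= B x j by apply: iint_ge0 => t; exact: F0.
have mphi' x i : rmeas (phi' x i).
  case: i => [i|] /=; first exact: rmeas_slice.
  by apply: rmeas_integral => //; exact: rmeas_hcons.
have phi'0 x i t : 0 <= phi' x i t by case: i => [i|] /=; [exact: phi0|exact: integral_ge0].
have inner x : iint (fun t => (\big[mule/1]_(i <- s) phi i (hcons x t) `^ w i) *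
      \big[mule/1]_(j < n.+1) lineint j (F j) (hcons x t) `^ m) <=
    K `^ m * ((\big[mule/1]_(i <- s) A x i `^ w i) * \big[mule/1]_(j < n) B x j `^ m).
  have := IH _ s' (phi' x) w' (F' x) (mphi' x) (phi'0 x).
  rewrite /s' !big_cons !big_map /=.
  have -> : iint (fun t => \int[mu]_y F ord0 (hcons y t)) = K.
    rewrite -(@iint_tonelli _ _ (fun y t => F ord0 (hcons y t)))//.
    exact: rmeas_hcons.
  have w'0 i : (0 <= w' i)%R by case: i.
  have mF' j : rmeas (F' x j) by exact: rmeas_slice.
  have F'0 j t : 0 <= F' x j t by exact: F0.
  (* The new function brings the weight [m] and one direction disappears, so the total is still 1.
     In dimension zero no direction is left to offset it, hence the guard. *)
  have sw : ((0 < n)%N -> m + \sum_(i <- s) w i + n.-1%:R * m = 1)%R.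
    case: (n) wm => [//|k] wm _.
    by rewrite addrAC -[RHS]wm addrC -[X in (_ + (X + _))%R]mul1r -mulrDl nat1r.
  move=> /(_ w'0 mF' F'0 m0 sw); rewrite -muleA; apply: le_trans.
  rewrite le_eqVlt; apply/orP; left; apply/eqP; apply: eq_iint => t.
  rewrite big_ord_recl big_cons big_map /= [X in _ = X * _]muleC -muleA; congr (_ * _).
  congr (_ `^ _ * _).
    by apply: eq_integral => y _; rewrite upd_hcons0.
  apply: eq_bigr => j _; congr (_ `^ _).
  by apply: eq_integral => y _; rewrite upd_hconsS.
pose G x := (\big[mule/1]_(i <- s) A x i `^ w i) * \big[mule/1]_(j < n) B x j `^ m.
have mG : measurable_fun setT (G : TR -> \bar R).
  apply: emeasurable_funM; apply: emeasurable_prod => i.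
    by apply: (measurable_fun_poweR _ (mA i)).
  by apply: (measurable_fun_poweR _ (mB i)).
have G0 x : 0 <= G x.
  by apply: mule_ge0; apply: prode_ge0 => i; exact: poweR_ge0.
have mfull : rmeas (fun x => (\big[mule/1]_(i <- s) phi i x `^ w i) *
      \big[mule/1]_(j < n.+1) lineint j (F j) x `^ m).
  apply: rmeas_mule; apply: rmeas_prod => i; apply: rmeas_poweR => //.
  exact: rmeas_lineint.
have full0 x : 0 <= (\big[mule/1]_(i <- s) phi i x `^ w i) *
      \big[mule/1]_(j < n.+1) lineint j (F j) x `^ m.
  by apply: mule_ge0; apply: prode_ge0 => i; exact: poweR_ge0.
apply: (@le_trans _ _ (\int[mu]_x (K `^ m * G x))).
  apply: ge0_le_integral => //.
  - by move=> x _; exact: iint_ge0.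
  - exact: (measurable_iint_hcons mfull).
  - by apply: emeasurable_funM.
  - by move=> x _; exact: inner.
rewrite (ge0_integralZl mu measurableT mG (fun x _ => G0 x) (poweR_ge0 K m)).
rewrite big_ord_recl [leRHS]muleCA -/K.
apply: lee_wpmul2l; first exact: poweR_ge0.
(* Hoelder in the first coordinate, over both families at once: the [A x i] with weights [w i] and
   the [n] functions [B x j] with weight [m] each. *)
pose f (k : I + 'I_n) x := match k with inl i => A x i | inr j => B x j end.
pose v (k : I + 'I_n) := match k with inl i => w i | inr j => m end.
have mf k : measurable_fun setT (f k : TR -> \bar R) by case: k.
have f0 k x : 0 <= f k x by case: k => [i|j] /=.
have v0 k : (0 <= v k)%R by case: k.
have sv : (\sum_(k <- map inl s ++ map inr (index_enum 'I_n)) v k = 1)%R.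
  rewrite big_cat !big_map /= -[RHS]wm; congr (_ + _)%R.
  by rewrite sumr_const card_ord mulr_natl.
have := hoelder_seq mu mf f0 v0 sv.
rewrite big_cat !big_map /=; apply: le_trans.
rewrite le_eqVlt; apply/orP; left; apply/eqP; apply: eq_integral => x _.
by rewrite big_cat !big_map.
Qed.

End gagliardo.

(** * Estimates along a line *)

Section line_estimates.
Context {R : realType}.
Local Notation mu := (@lebesgue_measure R).
Local Notation TR := (measurableTypeR R).

Lemma norm_diff_le_integral (h h' : R -> R) (a b : R) :
  (forall t : R, is_derive t (1 : R) h (h' t)) -> continuous h' -> a <= b ->
  ((`|h b - h a|)%:E <= \int[mu]_(t in `[a, b]) (`|h' t|)%:E)%E.
Proof.
move=> dh ch' ab.
have ch : continuous h.
  move=> t; apply: differentiable_continuous; apply/derivable1_diffP.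
  by have [] := dh t.
move: ab; rewrite le_eqVlt => /predU1P[->|ab].
  by rewrite subrr normr0 integral_ge0// => t _; rewrite lee_fin.
have := @continuous_FTC2 R h' h a b ab.
have cw : {within `[a, b], continuous h'} by apply: continuous_subspaceT.
move=> /(_ cw) H.
have Hd : derivable_oo_LRcontinuous h a b.
  split.
  - by move=> t _; have [] := dh t.
  - by apply: cvg_at_right_filter; exact: ch.
  - by apply: cvg_at_left_filter; exact: ch.
have He : {in `]a, b[, (h^`())%classic =1 h'}.
  by move=> t _; rewrite derive1E; have [] := dh t.
have {Hd He}H := H Hd He.
rewrite -abse_EFin EFinB -H.
apply: le_abse_integral => //; apply/measurable_EFinP.
by apply: measurable_funTS; exact: continuous_measurable_fun.
Qed.

(** For every [t] of the segment, [|h a|] is at most [|h t|] plus the integral of [|h'|]; averaging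
    over [t] gives the claim. Both constants are therefore rewritten as integrals over a segment of
    length [L]. *)
Lemma norm_le_integral_line (h h' : R -> R) (a L : R) :
  (forall t : R, is_derive t (1 : R) h (h' t)) -> continuous h' -> 0 < L ->
  ((`|h a|)%:E <= \int[mu]_(t in `[a, (a + L)%R]) (`|h' t| + `|h t| / L)%R%:E)%E.
Proof.
move=> dh ch' L0.
have ch : continuous h.
  move=> t; apply: differentiable_continuous; apply/derivable1_diffP.
  by have [] := dh t.
have mh : measurable_fun setT h by exact: continuous_measurable_fun.
have mh' : measurable_fun setT h' by exact: continuous_measurable_fun.
have aL : a <= a + L by rewrite lerDl ltW.
have Li0 : 0 <= L^-1 by rewrite invr_ge0 ltW.
have mI : mu `[a, a + L]%classic = L%:E.
  by rewrite lebesgue_measure_itv/= lte_fin ltrDl L0 -EFinB addrAC subrr add0r.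
have cI c : (\int[mu]_(t in `[a, (a + L)%R]) cst c t = c * L%:E)%E.
  by rewrite -mI; exact: integral_cst.
pose D := (\int[mu]_(t in `[a, (a + L)%R]) (`|h' t|)%:E)%E.
have D0 : (0 <= D)%E by apply: integral_ge0 => t _; rewrite lee_fin.
have mah : measurable_fun `[a, a + L] (fun t => (`|h t| / L)%:E).
  apply/measurable_EFinP; apply: measurable_funTS.
  by apply: measurable_funM => //; exact: measurableT_comp.
have mah' : measurable_fun `[a, a + L] (fun t => (`|h' t|)%:E).
  by apply/measurable_EFinP; apply: measurable_funTS; exact: measurableT_comp.
under eq_integral do rewrite EFinD.
rewrite ge0_integralD//; last first.
  by move=> t _; rewrite lee_fin divr_ge0// ltW.
rewrite -/D.
have -> : (`|h a|)%:E = (\int[mu]_(t in `[a, (a + L)%R]) cst (`|h a| / L)%R%:E t)%E.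
  by rewrite cI -EFinM divfK ?gt_eqF.
have -> : D = (\int[mu]_(t in `[a, (a + L)%R]) cst (L^-1%:E * D) t)%E.
  by rewrite cI muleAC -EFinM mulVf ?gt_eqF// mul1e.
rewrite -ge0_integralD//; last 2 first.
- by move=> t _; rewrite mule_ge0.
- by move=> t _; rewrite lee_fin divr_ge0// ltW.
apply: ge0_le_integral => //.
- by move=> t _; rewrite lee_fin divr_ge0// ltW.
- by apply: emeasurable_funD.
move=> t /=; rewrite in_itv/= => /andP[at1 ta].
rewrite [(`|h a| / L)]mulrC [(`|h t| / L)]mulrC !EFinM -ge0_muleDr ?lee_fin//.
apply: lee_wpmul2l => //.
have -> : h a = h t - (h t - h a) by rewrite opprB addrC subrK.
apply: (@le_trans _ _ ((`|h t - h a|)%:E + (`|h t|)%:E)%E).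
  by rewrite -EFinD lee_fin [leRHS]addrC ler_normB.
apply: leeD => //; apply: (le_trans (norm_diff_le_integral dh ch' at1)).
apply: ge0_subset_integral => //.
by move=> s /=; rewrite !in_itv/= => /andP[-> st]; rewrite (le_trans st).
Qed.

(** The path is affine with direction [v], so the difference quotients of the composite and of the
    directional derivative are the same function. *)
Lemma is_derive_path n (f : 'rV[R]_n -> R) (g : R -> 'rV[R]_n) (v : 'rV[R]_n) (t : R) :
  (forall h s, g (h + s) = h *: v + g s) -> differentiable f (g t) ->
  is_derive t (1 : R) (fun s => f (g s)) ('D_v f (g t)).
Proof.
move=> gE df.
have E : (fun h => h^-1 *: ((f \o g) (h *: 1 + t) - (f \o g) t)) =
         (fun h => h^-1 *: (f (h *: v + g t) - f (g t))).
  by apply/funext => h; rewrite /= gE /GRing.scale/= mulr1.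
split.
- by rewrite /derivable E; apply: diff_derivable.
- by rewrite /derive E.
Qed.

End line_estimates.

(** * Interpolation on annuli *)

Section annuli.
Context {R : realType}.
Local Notation mu := (@lebesgue_measure R).
Local Notation TR := (measurableTypeR R).

Lemma poweRD_ge0 (x : \bar R) (a b : R) : 0 <= a -> 0 <= b ->
  (x `^ (a + b) = x `^ a * x `^ b)%E.
Proof.
move=> a0 b0; have [->|aN0] := eqVneq a 0; first by rewrite add0r poweRe0 mul1e.
by rewrite poweRD// add_neq0_poweRD_def// paddr_eq0// (negbTE aN0).
Qed.

Lemma poweR_mulrn_prod (x : \bar R) (m : R) n : 0 <= m ->
  (\big[mule/1]_(j < n) x `^ m = x `^ (m * n%:R))%E.
Proof.
move=> m0; elim: n => [|n IH]; first by rewrite big_ord0 mulr0 poweRe0.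
rewrite big_ord_recl IH -poweRD_ge0//; last by rewrite mulr_ge0.
by rewrite -[X in (X + _)%R]mulr1 -mulrDr nat1r.
Qed.

Lemma lee_prod (I : Type) (s : seq I) (f g : I -> \bar R) :
  (forall i, 0 <= f i)%E -> (forall i, f i <= g i)%E ->
  (\big[mule/1]_(i <- s) f i <= \big[mule/1]_(i <- s) g i)%E.
Proof.
move=> f0 fg; elim: s => [|i s IH]; first by rewrite !big_nil.
by rewrite !big_cons lee_pmul// prode_ge0.
Qed.

Lemma le_poweR (x y : \bar R) (a : R) : 0 <= a -> (0 <= x)%E -> (x <= y)%E ->
  (x `^ a <= y `^ a)%E.
Proof.
move=> a0 x0 xy; apply: gt0_ler_poweR => //; rewrite in_itv/= leey andbT//.
exact: le_trans xy.
Qed.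

Lemma eucl_ge0 n (x : 'rV[R]_n) : 0 <= eucl x.
Proof. exact: sqrtr_ge0. Qed.

Lemma normr_coord_le_eucl n (x : 'rV[R]_n) i : `|x 0 i| <= eucl x.
Proof.
rewrite -sqrtr_sqr ler_wsqrtr// (bigD1 i)//= lerDl.
by apply: sumr_ge0 => j _; exact: sqr_ge0.
Qed.

Lemma euclZ n (a : R) (x : 'rV[R]_n) : 0 <= a -> eucl (a *: x) = a * eucl x.
Proof.
move=> a0; rewrite /eucl -[a in RHS]ger0_norm// -sqrtr_sqr -sqrtrM ?sqr_ge0//.
by rewrite mulr_sumr; congr Num.sqrt; apply: eq_bigr => i _; rewrite mxE exprMn.
Qed.

(** The Euclidean norm is 1-Lipschitz in each coordinate, [S] being the sum of the other squares:
    after squaring, only [x (y - x) <= e |y - x|] is needed. *)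
Lemma sqrt_sqrD_lip (x y S : R) : 0 <= S ->
  Num.sqrt (y ^+ 2 + S) <= Num.sqrt (x ^+ 2 + S) + `|y - x|.
Proof.
move=> S0; set e := Num.sqrt (x ^+ 2 + S).
have e0 : 0 <= e by exact: sqrtr_ge0.
have eE : e ^+ 2 = x ^+ 2 + S by rewrite sqr_sqrtr// addr_ge0// sqr_ge0.
have xe : `|x| <= e by rewrite -sqrtr_sqr ler_wsqrtr// lerDl.
have t0 : 0 <= `|y - x| by [].
rewrite -[leRHS]ger0_norm ?addr_ge0// -sqrtr_sqr ler_wsqrtr//.
have xt : x * (y - x) <= e * `|y - x|.
  by rewrite (le_trans (ler_norm _))// normrM ler_wpM2r.
have t2 : `|y - x| ^+ 2 = (y - x) ^+ 2 by rewrite real_normK ?num_real.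
rewrite sqrrD eE t2 -mulr_natl; lra.
Qed.

Lemma eucl_upd n (x : 'rV[R]_n) i y : `|eucl (upd x i y) - eucl x| <= `|y - x 0 i|.
Proof.
have -> : eucl (upd x i y) = Num.sqrt (y ^+ 2 + \sum_(j | j != i) x 0 j ^+ 2).
  rewrite /eucl (bigD1 i)//= mxE eqxx; congr (Num.sqrt (_ + _)).
  by apply: eq_bigr => j /negbTE ji; rewrite mxE ji.
have -> : eucl x = Num.sqrt (x 0 i ^+ 2 + \sum_(j | j != i) x 0 j ^+ 2).
  by rewrite /eucl (bigD1 i).
have S0 : 0 <= \sum_(j | j != i) x 0 j ^+ 2 by apply: sumr_ge0 => j _; exact: sqr_ge0.
rewrite ler_norml; apply/andP; split.
  by rewrite lerNl opprB lerBlDl distrC sqrt_sqrD_lip.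
by rewrite lerBlDl sqrt_sqrD_lip.
Qed.

Lemma rmeas_eucl n : rmeas (@eucl R n).
Proof.
move=> d Q c mc.
have ms : measurable_fun setT (@Num.sqrt R).
  by apply: continuous_measurable_fun; exact: sqrt_continuous.
have := measurableT_comp ms (g := fun z => \sum_(i < n) (c i z) ^+ 2).
rewrite (_ : _ \o _ = (fun z => eucl (\row_i c i z))).
  apply; apply: measurable_sum => i; exact: measurable_funX.
by apply/funext => z; congr Num.sqrt; apply: eq_bigr => i _; rewrite mxE.
Qed.

(** Half-open in the radius, like the shells, so that integrals over adjacent annuli add up
    exactly. *)
Definition mask n (a b : R) (G : 'rV[R]_n -> R) (x : 'rV[R]_n) : R :=
  if (a <= eucl x) && (eucl x < b) then G x else 0.

Definition aint n (a b : R) (G : 'rV[R]_n -> R) : \bar R :=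
  iint (fun x => (mask a b G x)%:E).

Lemma mask_ge0 n a b (G : 'rV[R]_n -> R) x : (forall x, 0 <= G x) -> (0 <= (mask a b G x)%:E)%E.
Proof. by move=> G0; rewrite lee_fin /mask; case: ifP. Qed.

Lemma rmeas_mask n a b (G : 'rV[R]_n -> R) : rmeas G -> rmeas (fun x => (mask a b G x)%:E).
Proof.
move=> mG d Q c mc; apply/measurable_EFinP; apply: measurable_fun_ifT => //.
  apply: measurable_and.
    by apply: measurable_fun_ler => //; exact: rmeas_eucl.
  by apply: measurable_fun_ltr => //; exact: rmeas_eucl.
exact: mG.
Qed.

Lemma aint_ge0 n a b (G : 'rV[R]_n -> R) : (forall x, 0 <= G x) -> (0 <= aint a b G)%E.
Proof. by move=> G0; apply: iint_ge0 => x; exact: mask_ge0. Qed.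

Lemma le_aint n a b a' b' (G H : 'rV[R]_n -> R) : rmeas G -> rmeas H ->
  (forall x, 0 <= G x) -> (forall x, 0 <= H x) ->
  a' <= a -> b <= b' -> (forall x, a <= eucl x < b -> G x <= H x) ->
  (aint a b G <= aint a' b' H)%E.
Proof.
move=> mG mH G0 H0 a'a bb' GH; apply: le_iint.
- exact: rmeas_mask.
- exact: rmeas_mask.
- by move=> x; exact: mask_ge0.
move=> x; rewrite lee_fin /mask; case: ifPn => [xab|_]; last by case: ifP.
have /andP[ax xb] := xab.
by rewrite (le_trans a'a ax) (lt_le_trans xb bb') /= GH.
Qed.

Lemma aintD n a b (G H : 'rV[R]_n -> R) : rmeas G -> rmeas H ->
  (forall x, 0 <= G x) -> (forall x, 0 <= H x) ->
  (aint a b (fun x => G x + H x)%R = aint a b G + aint a b H)%E.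
Proof.
move=> mG mH G0 H0; rewrite -iintD; first last.
- by move=> x; exact: mask_ge0.
- by move=> x; exact: mask_ge0.
- exact: rmeas_mask.
- exact: rmeas_mask.
by apply: eq_iint => x; rewrite /mask; case: ifP => _ /=; rewrite ?adde0.
Qed.

Lemma aintZ n a b (G : 'rV[R]_n -> R) (k : R) : rmeas G ->
  (forall x, 0 <= G x) -> 0 <= k ->
  (aint a b (fun x => k * G x)%R = k%:E * aint a b G)%E.
Proof.
move=> mG G0 k0; rewrite -iintZl//; first last.
- by move=> x; exact: mask_ge0.
- exact: rmeas_mask.
by apply: eq_iint => x; rewrite /mask; case: ifP => _ /=; rewrite ?mule0.
Qed.

Lemma aint_split n (a b c : R) (G : 'rV[R]_n -> R) : rmeas G -> (forall x, 0 <= G x) ->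
  a <= b -> b <= c -> (aint a c G = aint a b G + aint b c G)%E.
Proof.
move=> mG G0 ab bc; rewrite -iintD; first last.
- by move=> x; exact: mask_ge0.
- by move=> x; exact: mask_ge0.
- exact: rmeas_mask.
- exact: rmeas_mask.
apply: eq_iint => x; rewrite /mask; have [xb|bx] := ltP (eucl x) b.
  by rewrite (lt_le_trans xb bc) !andbT /= adde0; case: ifP.
by rewrite (le_trans ab bx)/= add0e.
Qed.

Lemma aint_scale n (a b c : R) (G : 'rV[R]_n -> R) : rmeas G -> (forall x, 0 <= G x) -> 0 < c ->
  (aint a b (fun x => G (c *: x))%R = (c ^- n)%R%:E * aint (c * a) (c * b) G)%E.
Proof.
move=> mG G0 c0; rewrite -iint_scale//; first last.
- by move=> x; exact: mask_ge0.
- exact: rmeas_mask.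
apply: eq_iint => x; rewrite /mask euclZ; last exact: ltW.
by rewrite ler_pM2l// ltr_pM2l.
Qed.

(* On the annulus [|w|] is at most its line integral in each direction, which is
   how the factors [lineint j F] of [iint_prod_lineint_le] enter. *)
Lemma annulus_interpolation n (w G : 'rV[R]_n.+1 -> R) (D : 'I_n.+1 -> 'rV[R]_n.+1 -> R)
    (a b L a' b' q u th d : R) :
  rmeas w -> rmeas G -> (forall x, 0 <= G x) ->
  (forall x i (y : R), is_derive y (1 : R) (fun y => w (upd x i y)) (D i (upd x i y))) ->
  (forall x i, continuous (fun y : R => D i (upd x i y))) ->
  (forall i x, `|D i x| <= G x) ->
  0 < L -> a' <= a - L -> b + L <= b' ->
  0 < q -> 0 < u -> 0 <= th <= 1 -> 0 <= d <= 1 ->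
  q * th * d + q * (1 - th) / u + n%:R * (q * th * (1 - d) / n.+1%:R) = 1 ->
  (aint a b (fun x => `|w x| `^ q)%R <=
    (L `^ (q * th * d))%:E * (aint a' b' (fun x => G x + `|w x| / L)%R) `^ (q * th)
    * (aint a b (fun x => `|w x| `^ u)%R) `^ (q * (1 - th) / u))%E.
Proof.
move=> mw mG G0 dw cD DG L0 a'a bb' q0 u0 /andP[th0 th1] /andP[d0 d1] hq.
(* The exponent [q th (1 - d)] shared equally among the [n.+1] directions. *)
pose m := q * th * (1 - d) / n.+1%:R.
have qth0 : 0 <= q * th by rewrite mulr_ge0// ltW.
have thC : 0 <= 1 - th by rewrite subr_ge0.
have dC : 0 <= 1 - d by rewrite subr_ge0.
have m0 : 0 <= m by apply: divr_ge0 => //; exact: mulr_ge0.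
have w10 : 0 <= q * th * d by exact: mulr_ge0.
have w20 : 0 <= q * (1 - th) / u by apply: divr_ge0; [apply: mulr_ge0 => //|]; exact: ltW.
have mwp p : rmeas (fun x => `|w x| `^ p).
  move=> dd Q c mc; apply: (measurableT_comp (f := fun t => t `^ p)) => //.
  by apply: measurableT_comp => //; exact: mw.
have mwn : rmeas (fun x => `|w x|).
  by move=> dd Q c mc; apply: measurableT_comp => //; exact: mw.
pose FR x := G x + `|w x| / L.
have mFR : rmeas FR.
  move=> dd Q c mc; apply: measurable_funD; first exact: mG.
  by apply: measurable_funM => //; exact: mwn.
have FR0 x : 0 <= FR x by rewrite addr_ge0// divr_ge0// ltW.
pose F x := (mask a' b' FR x)%:E.
have mF : rmeas F by exact: rmeas_mask.
have F0 x : (0 <= F x)%E by exact: mask_ge0.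
have pt i x : a <= eucl x < b -> ((`|w x|)%:E <= lineint i F x)%E.
  move=> /andP[ax xb].
  have xE : upd x i (x 0 i) = x.
    by apply/rowP => j; rewrite mxE; case: eqP => [->|].
  have /= := @norm_le_integral_line R _ _ (x 0 i) L (dw x i) (cD x i) L0.
  rewrite xE => /le_trans; apply.
  have mFu : measurable_fun setT (fun y : TR => F (upd x i y)).
    apply: (mF _ TR (fun j y => if j == i then y else x 0 j)) => j.
    by case: (j == i).
  apply: (@le_trans _ _ (\int[mu]_(y in `[x 0%R i, (x 0 i + L)%R]) F (upd x i y))%E).
    apply: ge0_le_integral => //.
    - by move=> y _; rewrite lee_fin addr_ge0// divr_ge0// ltW.
    - apply/measurable_EFinP; apply: measurable_funTS; apply: measurable_funD.
        by apply: measurableT_comp => //; apply: continuous_measurable_fun; exact: cD.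
      apply: measurable_funM => //; apply: measurableT_comp => //.
      apply: (mw _ TR (fun j y => if j == i then y else x 0 j)) => j.
      by case: (j == i).
    - by apply: measurable_funTS.
    move=> y /=; rewrite in_itv/= => /andP[xy yL].
    have tL : `|y - x 0 i| <= L by rewrite ger0_norm ?subr_ge0// lerBlDl.
    have := le_trans (eucl_upd x i y) tL; rewrite ler_norml => /andP[e1 e2].
    have i1 : a' <= eucl (upd x i y) by lra.
    have i2 : eucl (upd x i y) < b' by lra.
    by rewrite /F /mask i1 i2 lee_fin lerD2r.
  by apply: ge0_subset_integral.
(* The two full functions of the Hoelder step: [|w|] with weight [q th d], later absorbed into
   [Phi], and [|w|^u], which produces the last factor. *)
pose phi (c : bool) x := (mask a b (fun x => if c then `|w x| else `|w x| `^ u) x)%:E.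
pose W (c : bool) := if c then q * th * d else q * (1 - th) / u.
have phiR0 (c : bool) x : 0 <= (if c then `|w x| else `|w x| `^ u).
  by case: c; rewrite ?powR_ge0.
have phi0 c x : (0 <= phi c x)%E by apply: mask_ge0 => y; exact: phiR0.
have mphi c : rmeas (phi c) by apply: rmeas_mask; case: c.
have W0 c : 0 <= W c by case: c.
have hs : (0 < n.+1)%N -> \sum_(i <- [:: true; false]) W i + n.+1.-1%:R * m = 1.
  by rewrite !big_cons big_nil addr0.
have main := iint_prod_lineint_le (s := [:: true; false]) (F := fun _ => F)
  mphi phi0 W0 (fun _ => mF) (fun _ => F0) m0 hs.
rewrite [leRHS]muleC big_cons big_cons big_nil mule1 poweR_mulrn_prod// in main.
have mE : m * n.+1%:R = q * th * (1 - d) by rewrite /m divfK.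
pose Phi := iint F.
have Phi0 : (0 <= Phi)%E by exact: iint_ge0.
apply: (@le_trans _ _ (iint (fun x => \big[mule/1]_(i <- [:: true; false]) phi i x `^ W i *
  \big[mule/1]_(j < n.+1) lineint j F x `^ m))%E).
  apply: le_iint.
  - exact: rmeas_mask.
  - apply: rmeas_mule; apply: rmeas_prod => i; apply: rmeas_poweR => //.
    exact: rmeas_lineint.
  - by move=> x; apply: mask_ge0 => y; exact: powR_ge0.
  move=> x; rewrite /mask; case: ifPn => [xab|_]; last first.
    by rewrite mule_ge0// prode_ge0// => i; exact: poweR_ge0.
  have h1 : (\big[mule/1]_(j < n.+1) ((`|w x|)%:E `^ m) <=
      \big[mule/1]_(j < n.+1) lineint j F x `^ m)%E.
    apply: lee_prod => j; first exact: poweR_ge0.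
    by apply: le_poweR => //; exact: pt.
  rewrite poweR_mulrn_prod// mE poweR_EFin in h1.
  apply: (@le_trans _ _ ((\big[mule/1]_(i <- [:: true; false]) phi i x `^ W i) *
     (`|w x| `^ (q * th * (1 - d)))%:E)%E); last first.
    by apply: lee_wpmul2l => //; apply: prode_ge0 => i; exact: poweR_ge0.
  rewrite !big_cons big_nil mule1 /phi /mask xab /W !poweR_EFin -!EFinM lee_fin.
  rewrite -powRrM.
  have [->|wx] := eqVneq `|w x| 0.
    by rewrite [leLHS]powR0 ?gt_eqF// !mulr_ge0 ?powR_ge0.
  rewrite -!powRD; try by rewrite wx implybT.
  (* The three exponents of [|w|] add up: q th d + q (1 - th) + q th (1 - d) = q. *)
  rewrite le_eqVlt; apply/orP; left; apply/eqP; congr (_ `^ _).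
  have -> : u * (q * (1 - th) / u) = q * (1 - th) by rewrite mulrC divfK ?gt_eqF.
  by ring.
apply: (le_trans main); rewrite mE -/Phi.
(* The zeroth-order part of the field suffices: [|w| <= L (G + |w| / L)]. This is the origin of the
   power of [L]. *)
have hL : (iint (phi true) <= L%:E * Phi)%E.
  rewrite -iintZl ?(ltW L0)//; apply: le_iint => //.
    move=> dd Q c mc; apply: measurable_funeM; exact: mF.
  move=> x; rewrite /phi /F -EFinM lee_fin /mask.
  case: ifP => [/andP[ax xb]|_]; last first.
    by case: ifP => _; rewrite ?mulr0// mulr_ge0// ltW.
  have -> : a' <= eucl x by lra.
  have -> : eucl x < b' by lra.
  by rewrite /= /FR mulrDr mulrCA mulfV ?gt_eqF// mulr1 lerDr mulr_ge0// ltW.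
apply: (@le_trans _ _ ((L%:E * Phi) `^ (q * th * d) * Phi `^ (q * th * (1 - d)) *
   iint (phi false) `^ (q * (1 - th) / u))%E).
  rewrite muleA; apply: lee_wpmul2r; first exact: poweR_ge0.
  rewrite muleC; apply: lee_wpmul2r; first exact: poweR_ge0.
  by apply: le_poweR => //; exact: iint_ge0.
rewrite poweRM ?lee_fin ?(ltW L0)// poweR_EFin.
rewrite -[X in (X * _ <= _)%E]muleA -poweRD_ge0//; last first.
  by rewrite mulr_ge0// subr_ge0.
by have -> : q * th * d + q * th * (1 - d) = q * th by ring.
Qed.

End annuli.

(** * Elementary inequalities for real powers *)

Section powR_inequalities.
Context {R : realType}.

Lemma le_powR (x y a : R) : 0 <= a -> 0 <= x -> x <= y -> x `^ a <= y `^ a.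
Proof. by move=> a0 x0 xy; apply: ge0_ler_powR => //; rewrite nnegrE// (le_trans x0). Qed.

(** Either [b <= e a] or [a < b / e]. No convexity enters, so every [q >= 0] is allowed, and a small
    [e] keeps the coefficient of the first term close to 1, which the contraction in the recursion
    requires. *)
Lemma powR_add_le (a b q e : R) : 0 <= a -> 0 <= b -> 0 <= q -> 0 < e ->
  (a + b) `^ q <= (1 + e) `^ q * a `^ q + (1 + e^-1) `^ q * b `^ q.
Proof.
move=> a0 b0 q0 e0; have ei : 0 < e^-1 by rewrite invr_gt0.
have [bea|eab] := leP b (e * a).
  apply: (@le_trans _ _ (((1 + e) * a) `^ q)).
    by apply: le_powR; rewrite ?addr_ge0// mulrDl mul1r lerD2l.
  rewrite powRM//; last by rewrite addr_ge0// ltW.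
  by rewrite lerDl mulr_ge0// powR_ge0.
apply: (@le_trans _ _ (((1 + e^-1) * b) `^ q)).
  apply: le_powR; rewrite ?addr_ge0// mulrDl mul1r addrC lerD2l.
  by rewrite mulrC ler_pdivlMr// mulrC ltW.
rewrite powRM//; last by rewrite addr_ge0// ltW.
by rewrite lerDr mulr_ge0// powR_ge0.
Qed.

(** Beyond [t] one has [y / t <= (y / t)^u]. The free threshold [t] lets an integral of [|f|] be
    bounded by a volume and an integral of [|f|^u], the two being balanced later. *)
Lemma le_powR_scaled (y t u : R) : 0 <= y -> 0 < t -> 1 <= u ->
  y <= t + t * (t^-1) `^ u * y `^ u.
Proof.
move=> y0 t0 u1; have ti : 0 < t^-1 by rewrite invr_gt0.
rewrite -mulrA -powRM ?(ltW ti)//.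
have [yt|ty] := leP y t.
  by rewrite (le_trans yt)// lerDl mulr_ge0 ?powR_ge0// ltW.
have h : 1 <= t^-1 * y by rewrite mulrC ler_pdivlMr// mul1r ltW.
have := ler_powR h u1; rewrite powRr1; last by rewrite (le_trans _ h).
move=> /(ler_wpM2l (ltW t0)); rewrite mulrA mulfV ?gt_eqF// mul1r => /le_trans; apply.
by rewrite lerDr ltW.
Qed.

End powR_inequalities.

(** * Volume bound for balls by cubes *)

Section box.
Local Open Scope ereal_scope.
Context {R : realType}.
Local Notation mu := (@lebesgue_measure R).
Local Notation TR := (measurableTypeR R).

Definition box_indic n (b : R) (x : 'rV[R]_n) : R :=
  if [forall i, (`|x 0%R i| <= b)%R] then 1%R else 0%R.

Lemma rmeas_box_indic n b : rmeas (@box_indic n b).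
Proof.
move=> d Q c mc; apply: measurable_fun_ifT => //.
apply: (measurable_fun_bool true); rewrite setTI.
rewrite (_ : _ @^-1` _ = \bigcap_i [set z | `|c i z| <= b]%R).
  apply: fin_bigcap_measurable => // i _.
  rewrite -[X in measurable X]setTI.
  have : measurable_fun setT (fun z => `|c i z| <= b)%R.
    by apply: measurable_fun_ler => //; apply: measurableT_comp.
  by move=> /(_ measurableT [set true]); apply.
apply/seteqP; split => z /=.
  by move/forallP => h i _; have := h i; rewrite mxE.
by move=> h; apply/forallP => i; rewrite mxE; exact: h.
Qed.

Lemma iint_box_indic n (b : R) : (0 < b)%R ->
  iint (fun x : 'rV[R]_n => (box_indic b x)%:E) = ((2 * b) ^+ n)%R%:E.
Proof.
move=> b0; elim: n => [|n IH].
  by rewrite /= /box_indic; case: ifPn => // /forallPn[[]].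
have hc (x : R) (t : 'rV[R]_n) :
    box_indic b (hcons x t) = (if (`|x| <= b)%R then box_indic b t else 0%R).
  rewrite /box_indic; case: ifPn => [/forallP h|/forallPn[i hi]].
    have := h ord0; rewrite hcons0 => ->.
    by case: ifPn => // /forallPn[j]; have := h (lift ord0 j); rewrite hconsS => ->.
  case: ifPn => // xb; case: ifPn => // /forallP ht; move: hi.
  case: (unliftP ord0 i) => [j ->|->]; first by rewrite hconsS ht.
  by rewrite hcons0 xb.
transitivity (\int[mu]_(x in `[(- b)%R, b]) cst ((2 * b) ^+ n)%R%:E x).
  rewrite /= [RHS]integral_mkcond; apply: eq_integral => x _.
  rewrite patchE; case: ifPn => [|].
    rewrite inE/= in_itv/= -ler_norml => xb; rewrite -IH.
    by apply: eq_iint => t; rewrite -/(hcons x t) hc xb.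
  rewrite notin_setE/= in_itv/= -ler_norml => /negP/negbTE xb.
  apply: etrans (iint_cst0 n).
  by apply: eq_iint => t; rewrite -/(hcons x t) hc xb.
rewrite integral_cst//= lebesgue_measure_itv/= lte_fin.
have -> : (- b < b)%R by rewrite gtrN.
by rewrite -EFinB opprK -EFinM exprSr -mulr2n mulr_natl.
Qed.

Lemma aint_cst1_le n (b : R) : (0 < b)%R ->
  aint 0 b (fun _ : 'rV[R]_n => 1%R) <= ((2 * b) ^+ n)%R%:E.
Proof.
move=> b0; rewrite -iint_box_indic//; apply: le_iint.
- by apply: rmeas_mask => d Q c mc.
- by move=> d Q c mc; apply/measurable_EFinP; exact: rmeas_box_indic.
- by move=> x; exact: mask_ge0.
move=> x; rewrite lee_fin /mask /box_indic; case: ifPn => [/andP[_ xb]|_]; last by case: ifP.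
case: ifPn => // /forallPn[i]; rewrite -ltNge => bx.
by have := lt_trans xb bx; rewrite ltNge normr_coord_le_eucl.
Qed.

End box.

(** * Derivatives along coordinate axes and along rays *)

Section dilation.
Context {R : realType} (n : nat) (f : 'rV[R]_n.+1 -> R).
Hypothesis f1 : C1 f.
Local Notation mu := (@lebesgue_measure R).
Local Notation TR := (measurableTypeR R).

Lemma C1_differentiable x : differentiable f x. Proof. by have [] := f1. Qed.

Lemma C1_rmeas : rmeas f.
Proof. by apply: rmeas_continuous => x; apply: differentiable_continuous; exact: C1_differentiable. Qed.

Lemma rmeas_partial i : rmeas (partial i f).
Proof. by apply: rmeas_continuous; have [_] := f1. Qed.

Lemma rmeas_grad_norm : rmeas (grad_norm f).
Proof.
move=> d Q c mc.
have ms : measurable_fun setT (@Num.sqrt R).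
  by apply: continuous_measurable_fun; exact: sqrt_continuous.
apply: (measurableT_comp ms (g := fun z => \sum_(i < n.+1) partial i f (\row_i c i z) ^+ 2)).
by apply: measurable_sum => i; apply: measurable_funX; exact: rmeas_partial.
Qed.

Lemma grad_norm_ge0 x : 0 <= grad_norm f x. Proof. exact: sqrtr_ge0. Qed.

Lemma partial_le_grad_norm i x : `|partial i f x| <= grad_norm f x.
Proof.
rewrite -sqrtr_sqr ler_wsqrtr// (bigD1 i)//= lerDl.
by apply: sumr_ge0 => j _; exact: sqr_ge0.
Qed.

Lemma continuous_partial_path i (g : R -> 'rV[R]_n.+1) v :
  (forall h s, g (h + s) = h *: v + g s) -> continuous (fun t : R => partial i f (g t)).
Proof.
move=> gE t; have [_ /(_ i) cp] := f1.
have gE' : g = (fun s => s *: v + g 0) by apply/funext => s; rewrite -gE addr0.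
have cg : {for t, continuous g}.
  rewrite gE'; apply: cvgD; last exact: cvg_cst.
  by apply: cvgZr_tmp; exact: cvg_id.
exact: (continuous_comp cg (cp (g t))).
Qed.

Lemma upd_path (x : 'rV[R]_n.+1) i (h s : R) :
  upd x i (h + s) = h *: evec R i + upd x i s.
Proof.
apply/rowP => j; rewrite !mxE (eq_sym j i); case: (eqVneq i j) => _.
  by rewrite mulr1.
by rewrite mulr0 add0r.
Qed.

Lemma scale_upd_path (a : R) (x : 'rV[R]_n.+1) i (h s : R) :
  a *: upd x i (h + s) = h *: (a *: evec R i) + a *: upd x i s.
Proof. by rewrite upd_path scalerDr !scalerA mulrC. Qed.

Lemma is_derive_upd x i (y : R) :
  is_derive y (1 : R) (fun y => f (upd x i y)) (partial i f (upd x i y)).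
Proof. by apply: is_derive_path; [exact: upd_path|exact: C1_differentiable]. Qed.

Lemma is_derive_scale_upd (a : R) x i (y : R) :
  is_derive y (1 : R) (fun y => f (a *: upd x i y)) (a * partial i f (a *: upd x i y)).
Proof.
have -> : a * partial i f (a *: upd x i y) = 'D_(a *: evec R i) f (a *: upd x i y).
  rewrite /partial !deriveE; [|exact: C1_differentiable|exact: C1_differentiable].
  by rewrite linearZ.
by apply: (@is_derive_path _ _ f (fun y => a *: upd x i y));
  [exact: scale_upd_path|exact: C1_differentiable].
Qed.

Lemma is_derive_ray x (t : R) :
  is_derive t (1 : R) (fun t => f (t *: x)) (\sum_i x 0 i * partial i f (t *: x)).
Proof.
have -> : \sum_i x 0 i * partial i f (t *: x) = 'D_x f (t *: x).
  rewrite deriveE; last exact: C1_differentiable.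
  have xE : x = \sum_i x 0 i *: evec R i.
    apply/rowP => j; rewrite summxE (bigD1 j)//= big1 ?addr0.
      by rewrite !mxE eqxx mulr1.
    by move=> k /negbTE kj; rewrite !mxE kj mulr0.
  transitivity ('d f (t *: x) (\sum_i x 0 i *: evec R i)); last by rewrite -xE.
  rewrite linear_sum; apply: eq_bigr => i _.
  by rewrite linearZ /partial deriveE//; exact: C1_differentiable.
apply: (@is_derive_path _ _ f (fun t => t *: x)); last exact: C1_differentiable.
by move=> h s; rewrite scalerDl.
Qed.

Lemma dilation_le_integral_ray x :
  ((`|f x - f (2 *: x)|)%:E <= \int[mu]_(t in `[1%R, 2%R])
    (n.+1%:R * eucl x * grad_norm f (t *: x))%R%:E)%E.
Proof.
rewrite distrC -[X in f (2 *: x) - f X]scale1r.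
have ch : continuous (fun t : R => \sum_i x 0 i * partial i f (t *: x)).
  move=> t; apply: cvg_big => [|i _]; first exact: add_continuous.
  apply: cvgM; first exact: cvg_cst.
  apply: (@continuous_partial_path i (fun t => t *: x) x).
  by move=> h s; rewrite scalerDl.
have h12 : 1 <= 2 :> R by lra.
apply: (le_trans (norm_diff_le_integral (is_derive_ray x) ch h12)).
apply: ge0_le_integral => //.
- by apply/measurable_EFinP; apply: measurable_funTS; apply: measurableT_comp => //;
    exact: continuous_measurable_fun.
- apply/measurable_EFinP; apply: measurable_funTS; apply: measurable_funM => //.
  have := jmeas_measurable x (jmeas_scale rmeas_grad_norm); exact.
move=> t _; rewrite lee_fin (le_trans (ler_norm_sum _ _ _))//.
(* Each of the [n.+1] terms is at most [eucl x] times the norm of the gradient; this crude count is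
   the origin of the dimensional factor. *)
rewrite -mulrA mulr_natl -[X in _ *+ X](card_ord n.+1) -sumr_const.
apply: ler_sum => i _; rewrite normrM ler_pM//.
  exact: normr_coord_le_eucl.
exact: partial_le_grad_norm.
Qed.

End dilation.

(** * Comparison with a dilation *)

Section dilation_annulus.
Context {R : realType} (n : nat) (f : 'rV[R]_n.+1 -> R).
Hypothesis f1 : C1 f.
Local Notation mu := (@lebesgue_measure R).
Local Notation TR := (measurableTypeR R).

Definition dildiff (x : 'rV[R]_n.+1) : R := f x - f (2 *: x).
Local Notation w := dildiff.
Local Notation g := (grad_norm f).

Lemma rmeas_dildiff : rmeas w.
Proof.
move=> d Q c mc; apply: measurable_funB; first exact: C1_rmeas.
exact: (rmeas_scale 2 (C1_rmeas f1)).
Qed.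

Lemma rmeas_norm (h : 'rV[R]_n.+1 -> R) : rmeas h -> rmeas (fun x => `|h x|).
Proof. by move=> mh d Q c mc; apply: measurableT_comp => //; exact: mh. Qed.

Lemma rmeas_powR (h : 'rV[R]_n.+1 -> R) (p : R) : rmeas h -> rmeas (fun x => h x `^ p).
Proof.
move=> mh d Q c mc; apply: (measurableT_comp (measurable_powR p)); exact: mh.
Qed.

Lemma rmeas_mulr (h : 'rV[R]_n.+1 -> R) (k : R) : rmeas h -> rmeas (fun x => k * h x).
Proof. by move=> mh d Q c mc; apply: measurable_funM => //; exact: mh. Qed.

Lemma rmeas_addr (h k : 'rV[R]_n.+1 -> R) : rmeas h -> rmeas k -> rmeas (fun x => h x + k x).
Proof. by move=> mh mk d Q c mc; apply: measurable_funD; [exact: mh|exact: mk]. Qed.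

Let g0 := grad_norm_ge0 f.
Let mg : rmeas g := rmeas_grad_norm f1.

(** The ray estimate is integrated in [x] first, at fixed [t] in [[1, 2]]: the substitution [t *: x]
    has Jacobian factor [t ^- n.+1 <= 1] and sends the annulus into radii between [r / 4] and
    [4 r]. *)
Lemma aint_dildiff_le (r : R) : 0 < r ->
  (aint (r / 4) (2 * r) (fun x => `|w x|)%R <=
   (n.+1%:R * (2 * r))%R%:E * aint (r / 4) (4 * r) g)%E.
Proof.
move=> r0; pose K := n.+1%:R * (2 * r).
have K0 : 0 <= K by rewrite /K mulr_ge0// mulr_ge0// ltW.
pose m t x := mask (r / 4) (2 * r) (fun x => g (t *: x)) x.
have m0 t x : 0 <= m t x by rewrite -lee_fin; exact: mask_ge0.
(* The cut-off in [t] is built into the integrand because [iint_tonelli] integrates over the whole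
   line. *)
pose H (t : TR) (x : 'rV[R]_n.+1) : \bar R :=
  (if (1 <= t) && (t <= 2) then K * m t x else 0)%:E.
have H0 t x : (0 <= H t x)%E by rewrite lee_fin; case: ifP => // _; exact: mulr_ge0.
have jH : jmeas H.
  move=> d Q p c mp mc; apply/measurable_EFinP; apply: measurable_fun_ifT => //.
    by apply: measurable_and; exact: measurable_fun_ler.
  apply: measurable_funM => //; apply: measurable_fun_ifT => //.
    apply: measurable_and.
      by apply: measurable_fun_ler => //; exact: rmeas_eucl.
    by apply: measurable_fun_ltr => //; exact: rmeas_eucl.
  exact: (jmeas_scale mg mp mc).
have mHx x : measurable_fun setT (H^~ x) by exact: jmeas_measurable jH.
have s1 : (aint (r / 4) (2 * r) (fun x => `|w x|)%R <= iint (fun x => \int[mu]_t H t x))%E.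
  apply: le_iint.
  - by apply: rmeas_mask; apply: rmeas_norm; exact: rmeas_dildiff.
  - exact: rmeas_integral.
  - by move=> x; exact: mask_ge0.
  move=> x; rewrite /mask; case: ifPn => [xr|_]; last exact: integral_ge0.
  apply: (le_trans (dilation_le_integral_ray f1 x)).
  have mi : measurable_fun `[(1 : R), (2 : R)] (fun t : TR => (n.+1%:R * eucl x * g (t *: x))%:E).
    apply/measurable_EFinP; apply: measurable_funTS; apply: measurable_funM => //.
    have := jmeas_measurable x (jmeas_scale mg); exact.
  rewrite integral_mkcond; apply: ge0_le_integral => //.
  - move=> t _; rewrite patchE; case: ifP => // _.
    by rewrite lee_fin !mulr_ge0// eucl_ge0.
  - exact/(measurable_restrictT _ _).1.
  move=> t _; rewrite patchE; case: ifPn => [|_]; last exact: H0.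
  rewrite inE/= in_itv/= => t12; rewrite /H t12 lee_fin /m /mask xr /K.
  rewrite ler_wpM2r// ler_wpM2l// ltW//.
  by have /andP[] := xr.
apply: (le_trans s1); rewrite -iint_tonelli//.
set c := (_ * aint _ _ g)%E.
have c0 : (0 <= c)%E by rewrite mule_ge0// aint_ge0.
have mI : mu `[(1 : R), (2 : R)]%classic = 1%:E.
  by rewrite lebesgue_measure_itv/= lte_fin ltr1n -EFinB; congr EFin; lra.
have -> : c = (\int[mu]_(t in `[1%R, 2%R]) cst c t)%E.
  by apply/esym; apply: etrans (integral_cst _ _ _) _ => //; rewrite [X in (_ * X)%E]mI mule1.
rewrite [leRHS]integral_mkcond; apply: ge0_le_integral => //.
- by move=> t _; exact: iint_ge0.
- exact: jmeas_iint.
- exact/(measurable_restrictT _ _).1.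
move=> t _; rewrite patchE; case: ifPn => [tI|tI].
  have t12 : (1 <= t) && (t <= 2) by move: tI; rewrite inE/= in_itv.
  have /andP[t1 t2] := t12.
  have t0 : 0 < t by exact: lt_le_trans t1.
  have mgt : rmeas (fun x => g (t *: x)) by exact: rmeas_scale.
  have E : iint (H t) = (K%:E * aint (r / 4) (2 * r) (fun x => g (t *: x)))%E.
    rewrite -iintZl//; first by apply: eq_iint => x; rewrite /H t12.
      exact: rmeas_mask.
    by move=> x; exact: mask_ge0.
  have tn1 : ((t ^- n.+1)%R%:E <= 1 :> \bar R)%E.
    by rewrite lee_fin invf_le1 ?exprn_gt0// exprn_ege1.
  have tn0 : (0 <= (t ^- n.+1)%R%:E :> \bar R)%E.
    by rewrite lee_fin invr_ge0 exprn_ge0// ltW.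
  have i1 : r / 4 <= t * (r / 4) by rewrite ler_peMl// divr_ge0// ltW.
  have i2 : t * (2 * r) <= 4 * r.
    apply: (@le_trans _ _ (2 * (2 * r))); last by rewrite mulrA -natrM.
    by rewrite ler_wpM2r// mulr_ge0// ltW.
  have hA : (aint (t * (r / 4)) (t * (2 * r)) g <= aint (r / 4) (4 * r) g)%E.
    exact: (le_aint mg mg g0 g0 i1 i2 (fun x _ => lexx _)).
  have hB : (aint (r / 4) (2 * r) (fun x => g (t *: x)) <= aint (r / 4) (4 * r) g)%E.
    rewrite (aint_scale _ _ mg g0 t0) -[leRHS]mul1e.
    exact: (lee_pmul tn0 (aint_ge0 _ _ g0) tn1 hA).
  have hC := @lee_wpmul2l R K%:E K0 _ _ hB.
  by apply: le_trans hC; rewrite -E.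
have t12 : (1 <= t) && (t <= 2) = false.
  by move: tI; rewrite notin_setE/= in_itv/= => /negP/negbTE.
rewrite [leLHS](_ : _ = 0%E)//; apply: etrans (iint_cst0 n.+1).
by apply: eq_iint => x; rewrite /H t12.
Qed.

(** The three terms contribute 1, 2 (the dilation itself costs at most 1) and (4 / r) (n + 1) (2 r)
    = 8 (n + 1), with [n + 1] the dimension. *)
Lemma aint_dilfield_le (r : R) : 0 < r ->
  (aint (r / 4) (2 * r) (fun x => g x + 2 * g (2 *: x) + `|w x| / (r / 4))%R <=
   (3 + 8 * n.+1%:R)%R%:E * aint (r / 4) (4 * r) g)%E.
Proof.
move=> r0; set N := aint _ (4 * r) g.
have N0 : (0 <= N)%E by exact: aint_ge0.
have mg2 : rmeas (fun x => g (2 *: x)) by exact: rmeas_scale.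
have g20 x : 0 <= 2 * g (2 *: x) by rewrite mulr_ge0.
have m2g2 : rmeas (fun x => 2 * g (2 *: x)) by exact: rmeas_mulr.
have mw : rmeas (fun x => `|w x|) by apply: rmeas_norm; exact: rmeas_dildiff.
have ir0 : 0 <= (r / 4)^-1 by rewrite invr_ge0 divr_ge0// ltW.
have -> : (fun x => g x + 2 * g (2 *: x) + `|w x| / (r / 4)) =
          (fun x => g x + 2 * g (2 *: x) + (r / 4)^-1 * `|w x|).
  by apply/funext => x; rewrite [X in _ + X]mulrC.
rewrite aintD; last 4 first.
- exact: rmeas_addr.
- exact: rmeas_mulr.
- by move=> x; rewrite addr_ge0.
- by move=> x; rewrite mulr_ge0.
rewrite aintD// !aintZ//.
have -> : (3 + 8 * n.+1%:R)%R%:E = (1%:E + 2%:E + (8 * n.+1%:R)%R%:E)%E :> \bar R.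
  by rewrite -!EFinD; congr EFin; lra.
rewrite ge0_muleDl ?lee_fin ?mulr_ge0// ge0_muleDl ?lee_fin// mul1e.
apply: leeD.
  apply: leeD; first by apply: (le_aint mg mg g0 g0 _ _ (fun x _ => lexx _)); lra.
  apply: lee_wpmul2l; first by rewrite lee_fin.
  rewrite (aint_scale _ _ mg g0 (ltr0Sn R 1)) -[leRHS]mul1e.
  apply: (lee_pmul _ (aint_ge0 _ _ g0)).
  - by rewrite lee_fin invr_ge0 exprn_ge0.
  - by rewrite lee_fin invf_le1 ?exprn_gt0// exprn_ege1// ler1n.
  by apply: (le_aint mg mg g0 g0 _ _ (fun x _ => lexx _)); lra.
apply: (@le_trans _ _ (((r / 4)^-1)%:E * ((n.+1%:R * (2 * r))%R%:E * N)))%E.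
  by apply: lee_wpmul2l; [rewrite lee_fin|exact: aint_dildiff_le].
rewrite muleA -EFinM le_eqVlt; apply/orP; left; apply/eqP; congr (_%:E * _)%E.
by field; rewrite gt_eqF.
Qed.

Lemma aint_dildiff_interpolation (r q u th d : R) : 0 < r ->
  0 < q -> 0 < u -> 0 <= th <= 1 -> 0 <= d <= 1 ->
  q * th * d + q * (1 - th) / u + n%:R * (q * th * (1 - d) / n.+1%:R) = 1 ->
  (aint (r / 2) r (fun x => `|w x| `^ q)%R <=
    ((r / 4) `^ (q * th * d))%:E *
    ((3 + 8 * n.+1%:R)%R%:E * aint (r / 4) (4 * r) g) `^ (q * th)
    * (aint (r / 2) r (fun x => `|w x| `^ u)%R) `^ (q * (1 - th) / u))%E.
Proof.
move=> r0 q0 u0 th01 d01 hq; have /andP[th0 th1] := th01.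
have r40 : 0 < r / 4 by rewrite divr_gt0.
pose D i x := partial i f x - 2 * partial i f (2 *: x).
have mG : rmeas (fun x => g x + 2 * g (2 *: x)).
  by apply: rmeas_addr => //; apply: rmeas_mulr; exact: rmeas_scale.
have G0 x : 0 <= g x + 2 * g (2 *: x) by rewrite addr_ge0// mulr_ge0.
have dw x i (y : R) : is_derive y (1 : R) (fun y => w (upd x i y)) (D i (upd x i y)).
  by apply: is_deriveB; [exact: is_derive_upd|exact: is_derive_scale_upd].
have cD x i : continuous (fun y : R => D i (upd x i y)).
  move=> y; apply: cvgB; first exact: (continuous_partial_path f1 (upd_path x i)).
  apply: cvgM; first exact: cvg_cst.
  exact: (continuous_partial_path f1 (g := fun y => 2 *: upd x i y) (scale_upd_path 2 x i)).
have DG i x : `|D i x| <= g x + 2 * g (2 *: x).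
  rewrite (le_trans (ler_normB _ _))// normrM lerD ?partial_le_grad_norm//.
  by rewrite ger0_norm// ler_wpM2l// partial_le_grad_norm.
(* Segments of length [L = r / 4] issued from radii in [[r / 2, r)] stay in [[r / 4, 2 r)]. *)
have h1 : r / 4 <= r / 2 - r / 4 by lra.
have h2 : r + r / 4 <= 2 * r by lra.
apply: (le_trans (annulus_interpolation rmeas_dildiff mG G0 dw cD DG r40 h1 h2 q0 u0 th01 d01 hq)).
apply: lee_wpmul2r; first exact: poweR_ge0.
apply: lee_wpmul2l; first by rewrite lee_fin powR_ge0.
apply: le_poweR; first by rewrite mulr_ge0// ltW.
  by apply: aint_ge0 => x; rewrite addr_ge0// divr_ge0// ltW.
exact: aint_dilfield_le.
Qed.

Let mfp p : rmeas (fun x => `|f x| `^ p).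
Proof. by apply: rmeas_powR; apply: rmeas_norm; exact: C1_rmeas. Qed.
Let mf2p p : rmeas (fun x => `|f (2 *: x)| `^ p).
Proof. exact: (rmeas_scale 2 (mfp p)). Qed.
Let mwp p : rmeas (fun x => `|w x| `^ p).
Proof. by apply: rmeas_powR; apply: rmeas_norm; exact: rmeas_dildiff. Qed.

Lemma aint_powR_double (r p : R) :
  (aint (r / 2) r (fun x => `|f (2 *: x)| `^ p)%R =
   (2 ^- n.+1)%R%:E * aint r (2 * r) (fun x => `|f x| `^ p)%R)%E.
Proof.
rewrite (aint_scale _ _ (mfp p) (fun x => powR_ge0 _ _) (ltr0Sn R 1)).
by congr (_ * aint _ _ _)%E; rewrite mulrC divfK.
Qed.

Lemma aint_dildiff_powR_le (r p : R) : 0 <= p ->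
  (aint (r / 2) r (fun x => `|w x| `^ p)%R <=
   (2 `^ p)%:E * (aint (r / 2) r (fun x => `|f x| `^ p)%R +
                  aint r (2 * r) (fun x => `|f x| `^ p)%R))%E.
Proof.
move=> p0.
apply: (@le_trans _ _ (aint (r / 2) r (fun x => 2 `^ p * (`|f x| `^ p + `|f (2 *: x)| `^ p)))).
  apply: (le_aint (mwp p) _ _ _ (lexx _) (lexx _)).
  - by apply: rmeas_mulr; exact: rmeas_addr.
  - by move=> x; exact: powR_ge0.
  - by move=> x; rewrite mulr_ge0 ?addr_ge0 ?powR_ge0.
  move=> x _; apply: (@le_trans _ _ ((`|f x| + `|f (2 *: x)|) `^ p)).
    by apply: le_powR => //; exact: ler_normB.
  have := @powR_add_le R `|f x| `|f (2 *: x)| p 1; rewrite invr1 => /(_ _ _ p0 ltr01).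
  by rewrite -mulrDr; apply.
rewrite (aintZ _ _ (rmeas_addr (mfp p) (mf2p p))
  (fun x => addr_ge0 (powR_ge0 _ _) (powR_ge0 _ _)) (powR_ge0 _ _)).
apply: lee_wpmul2l; first by rewrite lee_fin powR_ge0.
rewrite (aintD _ _ (mfp p) (mf2p p) (fun x => powR_ge0 _ _) (fun x => powR_ge0 _ _)).
apply: leeD; first exact: lexx.
rewrite aint_powR_double -[leRHS]mul1e.
apply: (lee_pmul _ (aint_ge0 _ _ (fun x => powR_ge0 _ _)) _ (lexx _)).
  by rewrite lee_fin invr_ge0 exprn_ge0.
by rewrite lee_fin invf_le1 ?exprn_gt0// exprn_ege1// ler1n.
Qed.

(** Here [f] is written [f(2 .) + w]. The Jacobian [2 ^- n.+1] of the dilation is what becomes, with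
    the weight of index [alpha1], the decay rate [gamma]. *)
Lemma aint_powR_step (r q e : R) : 0 <= q -> 0 < e ->
  (aint (r / 2) r (fun x => `|f x| `^ q)%R <=
   ((1 + e) `^ q * 2 ^- n.+1)%R%:E * aint r (2 * r) (fun x => `|f x| `^ q)%R +
   ((1 + e^-1) `^ q)%:E * aint (r / 2) r (fun x => `|w x| `^ q)%R)%E.
Proof.
move=> q0 e0.
rewrite EFinM -muleA -aint_powR_double.
rewrite -(aintZ _ _ (mf2p q) (fun x => powR_ge0 _ _) (powR_ge0 _ _)).
rewrite -(aintZ _ _ (mwp q) (fun x => powR_ge0 _ _) (powR_ge0 _ _)).
rewrite -aintD; last 4 first.
- exact: rmeas_mulr.
- exact: rmeas_mulr.
- by move=> x; rewrite mulr_ge0 ?powR_ge0.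
- by move=> x; rewrite mulr_ge0 ?powR_ge0.
apply: (le_aint (mfp q) _ _ _ (lexx _) (lexx _)).
- by apply: rmeas_addr; exact: rmeas_mulr.
- by move=> x; exact: powR_ge0.
- by move=> x; rewrite addr_ge0// mulr_ge0 ?powR_ge0.
move=> x _; apply: (@le_trans _ _ ((`|f (2 *: x)| + `|w x|) `^ q)).
  apply: le_powR => //.
  by rewrite -{1}[f x](subrK (f (2 *: x))) addrC ler_normD.
exact: powR_add_le.
Qed.

(** The point of this form is that the second constant depends on neither [r] nor [f], the whole
    scale being confined to the power of [r]. *)
Lemma aint_powR_recursion (r q u th d e : R) : 0 < r ->
  0 < q -> 0 < u -> 0 <= th <= 1 -> 0 <= d <= 1 -> 0 < e ->
  q * th * d + q * (1 - th) / u + n%:R * (q * th * (1 - d) / n.+1%:R) = 1 ->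
  (aint (r / 2) r (fun x => `|f x| `^ q)%R <=
   ((1 + e) `^ q * 2 ^- n.+1)%R%:E * aint r (2 * r) (fun x => `|f x| `^ q)%R +
   ((1 + e^-1) `^ q * 4^-1 `^ (q * th * d) * (3 + 8 * n.+1%:R) `^ (q * th)
      * (2 `^ u) `^ (q * (1 - th) / u))%R%:E *
   ((r `^ (q * th * d))%:E * (aint (r / 4) (4 * r) g) `^ (q * th) *
    (aint (r / 2) r (fun x => `|f x| `^ u)%R + aint r (2 * r) (fun x => `|f x| `^ u)%R)
      `^ (q * (1 - th) / u)))%E.
Proof.
move=> r0 q0 u0 th01 d01 e0 hq; have /andP[th0 th1] := th01.
have w20 : 0 <= q * (1 - th) / u.
  by rewrite divr_ge0 ?(ltW u0)// mulr_ge0 ?(ltW q0)// subr_ge0.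
have fu0 a b : (0 <= aint a b (fun x => `|f x| `^ u)%R)%E.
  by apply: aint_ge0 => x; exact: powR_ge0.
apply: (le_trans (aint_powR_step r (ltW q0) e0)); apply: leeD; first exact: lexx.
have := aint_dildiff_interpolation r0 q0 u0 th01 d01 hq.
set A := (aint (r / 2) r (fun x => `|w x| `^ q)%R).
move=> hA; rewrite 3!EFinM -4!muleA; apply: lee_wpmul2l.
  by rewrite lee_fin powR_ge0.
apply: (le_trans hA).
apply: (@le_trans _ _ (((r / 4) `^ (q * th * d))%:E *
    ((3 + 8 * n.+1%:R)%R%:E * aint (r / 4) (4 * r) g) `^ (q * th) *
    ((2 `^ u)%:E * (aint (r / 2) r (fun x => `|f x| `^ u)%R +
                  aint r (2 * r) (fun x => `|f x| `^ u)%R)) `^ (q * (1 - th) / u)))%E.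
  apply: lee_wpmul2l; first by rewrite mule_ge0 ?lee_fin ?powR_ge0 ?poweR_ge0.
  apply: le_poweR => //; first by apply: aint_ge0 => x; exact: powR_ge0.
  exact: (aint_dildiff_powR_le _ (ltW u0)).
have c30 : (0 <= (3 + 8 * n.+1%:R)%R%:E :> \bar R)%E by rewrite lee_fin.
have c20 : (0 <= (2 `^ u)%R%:E :> \bar R)%E by rewrite lee_fin powR_ge0.
rewrite (poweRM _ c30 (aint_ge0 _ _ g0)) (poweRM _ c20 (adde_ge0 (fu0 _ _) (fu0 _ _))).
rewrite powRM ?(ltW r0) ?invr_ge0// !poweR_EFin EFinM -!muleA.
set a1 := (r `^ _)%:E; set a2 := (4^-1 `^ _)%:E; set a3 := ((3 + _) `^ _)%:E.
set a4 := ((2 `^ u) `^ _)%:E; set b1 := (_ `^ (q * th))%E; set b2 := (_ `^ _)%E.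
rewrite le_eqVlt; apply/orP; left; apply/eqP.
rewrite [LHS]muleCA; congr (a2 * _)%E.
rewrite [LHS]muleCA; congr (a3 * _)%E.
by rewrite [RHS]muleCA; congr (a1 * _)%E; rewrite [LHS]muleCA.
Qed.

(** The annulus inequality for [f] instead of [w]: the integral of [|f|] stays uncontrolled by the
    gradient. It serves only for the a priori growth bound. *)
Lemma aint_powR_growth (r q u th d : R) : 0 < r ->
  0 < q -> 0 < u -> 0 <= th <= 1 -> 0 <= d <= 1 ->
  q * th * d + q * (1 - th) / u + n%:R * (q * th * (1 - d) / n.+1%:R) = 1 ->
  (aint (r / 2) r (fun x => `|f x| `^ q)%R <=
   ((r / 4) `^ (q * th * d))%:E *
   (aint (r / 4) (4 * r) g + ((r / 4)^-1)%:E * aint (r / 4) (2 * r) (fun x => `|f x|)%R)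
     `^ (q * th) *
   (aint (r / 2) r (fun x => `|f x| `^ u)%R) `^ (q * (1 - th) / u))%E.
Proof.
move=> r0 q0 u0 th01 d01 hq; have /andP[th0 th1] := th01.
have r40 : 0 < r / 4 by rewrite divr_gt0.
have ir0 : 0 <= (r / 4)^-1 by rewrite invr_ge0 ltW.
have mf : rmeas (fun x => `|f x|) by apply: rmeas_norm; exact: C1_rmeas.
have h1 : r / 4 <= r / 2 - r / 4 by lra.
have h2 : r + r / 4 <= 2 * r by lra.
apply: (le_trans (annulus_interpolation (D := fun i => partial i f) (C1_rmeas f1) mg g0
  (is_derive_upd f1) (fun x i => continuous_partial_path f1 (upd_path x i))
  (@partial_le_grad_norm _ _ f) r40 h1 h2 q0 u0 th01 d01 hq)).
apply: lee_wpmul2r; first exact: poweR_ge0.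
apply: lee_wpmul2l; first by rewrite lee_fin powR_ge0.
apply: le_poweR; first by rewrite mulr_ge0// ltW.
  by apply: aint_ge0 => x; rewrite addr_ge0// divr_ge0// ltW.
have -> : (fun x => g x + `|f x| / (r / 4)) = (fun x => g x + (r / 4)^-1 * `|f x|).
  by apply/funext => x; rewrite [X in _ + X]mulrC.
rewrite aintD//; last 2 first.
- exact: rmeas_mulr.
- by move=> x; rewrite mulr_ge0.
rewrite aintZ//; apply: leeD => //.
by apply: (le_aint mg mg g0 g0 _ _ (fun x _ => lexx _)); lra.
Qed.

Lemma aint_norm_le (r t u : R) : 0 < r -> 0 < t -> 1 <= u ->
  (aint (r / 4) (2 * r) (fun x => `|f x|)%R <=
   (t * (4 * r) ^+ n.+1)%R%:E +
   (t * t^-1 `^ u)%R%:E * aint (r / 4) (2 * r) (fun x => `|f x| `^ u)%R)%E.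
Proof.
move=> r0 t0 u1.
have mf : rmeas (fun x => `|f x|) by apply: rmeas_norm; exact: C1_rmeas.
have m1 : rmeas (fun _ : 'rV[R]_n.+1 => 1 : R) by move=> d Q c mc.
have mt : rmeas (fun _ : 'rV[R]_n.+1 => t * 1 : R) by move=> d Q c mc.
have tt0 : 0 <= t * t^-1 `^ u by rewrite mulr_ge0 ?powR_ge0// ltW.
apply: (@le_trans _ _ (aint (r / 4) (2 * r) (fun x => t * 1 + (t * t^-1 `^ u) * `|f x| `^ u))).
  apply: (le_aint mf _ _ _ (lexx _) (lexx _)).
  - by apply: rmeas_addr => //; exact: rmeas_mulr.
  - by move=> x.
  - by move=> x; rewrite addr_ge0 ?mulr_ge0 ?powR_ge0 ?ler01// ltW.
  - by move=> x _; rewrite mulr1; exact: le_powR_scaled.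
rewrite aintD//; last 3 first.
- exact: rmeas_mulr.
- by move=> x; rewrite mulr_ge0// ltW.
- by move=> x; rewrite mulr_ge0// powR_ge0.
rewrite (aintZ _ _ m1 (fun _ => ler01) (ltW t0)).
rewrite (aintZ _ _ (mfp u) (fun x => powR_ge0 _ _) tt0).
apply: leeD; last exact: lexx.
rewrite EFinM; apply: lee_wpmul2l; first by rewrite lee_fin ltW.
have r20 : 0 < 2 * r by rewrite mulr_gt0.
have := @aint_cst1_le R n.+1 _ r20; rewrite mulrA -natrM => h.
apply: le_trans h.
apply: (le_aint m1 m1 (fun _ => ler01) (fun _ => ler01) _ (lexx _) (fun _ _ => lexx _)).
by rewrite divr_ge0// ltW.
Qed.

End dilation_annulus.

(** * Sums over the integers *)

Section discrete.
Local Open Scope ereal_scope.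
Context {R : realType}.

Lemma poweR_add_le (x y : \bar R) (p e : R) : 0 <= x -> 0 <= y -> (0 < p)%R -> (0 < e)%R ->
  (x + y) `^ p <= ((1 + e) `^ p)%R%:E * x `^ p + ((1 + e^-1) `^ p)%R%:E * y `^ p.
Proof.
move=> x0 y0 p0 e0.
have c1 : (0 < (1 + e) `^ p)%R by rewrite powR_gt0// addr_gt0.
have c2 : (0 < (1 + e^-1) `^ p)%R by rewrite powR_gt0// addr_gt0// invr_gt0.
have [->|xoo] := eqVneq x +oo.
  apply: (le_trans (leey _)).
  rewrite (poweRyr (lt0r_neq0 p0)) gt0_muley ?lte_fin// addye// gt_eqF//.
  by rewrite (lt_le_trans (ltNyr 0%R))// mule_ge0 ?poweR_ge0// lee_fin ltW.
have [->|yoo] := eqVneq y +oo.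
  apply: (le_trans (leey _)).
  rewrite (poweRyr (lt0r_neq0 p0)) [X in _ + X]gt0_muley ?lte_fin// addey// gt_eqF//.
  by rewrite (lt_le_trans (ltNyr 0%R))// mule_ge0 ?poweR_ge0// lee_fin ltW.
have xf : x \is a fin_num by rewrite ge0_fin_numE// ltey.
have yf : y \is a fin_num by rewrite ge0_fin_numE// ltey.
rewrite -(fineK xf) -(fineK yf) -EFinD !poweR_EFin -!EFinM -EFinD lee_fin.
by apply: powR_add_le; rewrite ?fine_ge0// ltW.
Qed.

Lemma poweR_add4_le (x1 x2 x3 x4 : \bar R) (p : R) : 0 <= x1 -> 0 <= x2 -> 0 <= x3 ->
  0 <= x4 -> (0 < p)%R ->
  (x1 + x2 + (x3 + x4)) `^ p <=
    (4 `^ p)%R%:E * (x1 `^ p + x2 `^ p + (x3 `^ p + x4 `^ p)).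
Proof.
have h2 (a b : \bar R) (p0 : (0 < p)%R) : 0 <= a -> 0 <= b ->
    (a + b) `^ p <= (2 `^ p)%R%:E * (a `^ p + b `^ p).
  move=> a0 b0; have := poweR_add_le a0 b0 p0 ltr01.
  by rewrite invr1 -ge0_muleDr ?poweR_ge0.
move=> ? ? ? ? p0; apply: (le_trans (h2 _ _ p0 _ _)); rewrite ?adde_ge0//.
have -> : (4 `^ p = 2 `^ p * 2 `^ p :> R)%R by rewrite -powRM// -natrM.
rewrite EFinM -muleA; apply: lee_wpmul2l; first by rewrite lee_fin powR_ge0.
rewrite ge0_muleDr ?adde_ge0 ?poweR_ge0//.
by apply: leeD; exact: h2.
Qed.

Lemma esum_int_shift (a : int -> \bar R) (j : int) :
  \esum_(k in [set: int]) a (k + j)%R = \esum_(k in [set: int]) a k.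
Proof.
rewrite [RHS](@reindex_esum _ _ _ [set: int] _ (fun k => k + j)%R)//.
rewrite setTT_bijective; exists (fun k => k - j)%R => k; first by rewrite addrK.
by rewrite subrK.
Qed.

Lemma esumZl_le (T : choiceType) (a : T -> \bar R) (c : R) : (0 <= c)%R ->
  (forall k, 0 <= a k) ->
  \esum_(k in [set: T]) (c%:E * a k) <= c%:E * \esum_(k in [set: T]) a k.
Proof.
move=> c0 a0; apply: ub_ereal_sup => _ [F [Ff _] <-].
rewrite -ge0_mule_fsumr//; apply: lee_wpmul2l; first by rewrite lee_fin.
by apply: esum_ge; exists F.
Qed.

Lemma le_esum_term (T : choiceType) (a : T -> \bar R) k : (forall k, 0 <= a k) ->
  a k <= \esum_(k in [set: T]) a k.
Proof.
by move=> a0; apply: esum_ge; exists [set k]; [split|rewrite fsbig_set1].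
Qed.

Lemma esum_hoelder (T : choiceType) (P Q : T -> \bar R) (a b : R) :
  (forall k, 0 <= P k) -> (forall k, 0 <= Q k) ->
  (0 <= a)%R -> (0 <= b)%R -> (a + b = 1)%R ->
  \esum_(k in [set: T]) P k < +oo -> \esum_(k in [set: T]) Q k < +oo ->
  \esum_(k in [set: T]) (P k `^ a * Q k `^ b) <=
    (\esum_(k in [set: T]) P k) `^ a * (\esum_(k in [set: T]) Q k) `^ b.
Proof.
move=> P0 Q0 + + + SPy SQy.
have SP0 : 0 <= \esum_(k in [set: T]) P k by exact: esum_ge0.
have SQ0 : 0 <= \esum_(k in [set: T]) Q k by exact: esum_ge0.
rewrite le_eqVlt => /predU1P[<- _|a0].
  rewrite add0r => ->; rewrite poweRe0 mul1e poweRe1//.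
  by apply: le_esum => k _; rewrite poweRe0 mul1e poweRe1.
rewrite le_eqVlt => /predU1P[<-|b0].
  rewrite addr0 => ->; rewrite poweRe0 mule1 poweRe1//.
  by apply: le_esum => k _; rewrite poweRe0 mule1 poweRe1.
move=> ab.
have [SP|SP] := eqVneq (\esum_(k in [set: T]) P k) 0.
  rewrite esum1 ?mule_ge0 ?poweR_ge0// => k _.
  have -> : P k = 0 by apply/le_anti; rewrite P0 -SP le_esum_term.
  by rewrite poweR0r ?gt_eqF// mul0e.
have [SQ|SQ] := eqVneq (\esum_(k in [set: T]) Q k) 0.
  rewrite esum1 ?mule_ge0 ?poweR_ge0// => k _.
  have -> : Q k = 0 by apply/le_anti; rewrite Q0 -SQ le_esum_term.
  by rewrite poweR0r ?gt_eqF// mule0.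
have SPf : \esum_(k in [set: T]) P k \is a fin_num by rewrite ge0_fin_numE.
have SQf : \esum_(k in [set: T]) Q k \is a fin_num by rewrite ge0_fin_numE.
rewrite -(fineK SPf) -(fineK SQf).
set I := fine _; set J := fine _.
have I0 : (0 < I)%R by rewrite fine_gt0// lt_def SP SP0 SPy.
have J0 : (0 < J)%R by rewrite fine_gt0// lt_def SQ SQ0 SQy.
have IJ0 : (0 <= I `^ a * J `^ b)%R by rewrite mulr_ge0// powR_ge0.
rewrite !poweR_EFin -EFinM.
have k10 : (0 <= I `^ a * J `^ b * (a / I))%R by rewrite mulr_ge0// divr_ge0// ltW.
have k20 : (0 <= I `^ a * J `^ b * (b / J))%R by rewrite mulr_ge0// divr_ge0// ltW.
apply: (@le_trans _ _ (\esum_(k in [set: T]) ((I `^ a * J `^ b * (a / I))%R%:E * P k +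
                     (I `^ a * J `^ b * (b / J))%R%:E * Q k))).
  by apply: le_esum => k _; exact: poweR_young_scaled.
rewrite esumD; last 2 first.
- by move=> k _; rewrite mule_ge0.
- by move=> k _; rewrite mule_ge0.
apply: (le_trans (leeD (esumZl_le k10 P0) (esumZl_le k20 Q0))).
rewrite -(fineK SPf) -(fineK SQf) -/I -/J -!EFinM -EFinD lee_fin.
rewrite -!mulrA !mulVf ?gt_eqF// !mulr1.
by rewrite !mulrA -mulrDr ab mulr1.
Qed.

Lemma esum_swap (T1 T2 : choiceType) (a : T1 -> T2 -> \bar R) :
  (forall i j, 0 <= a i j) ->
  \esum_(i in [set: T1]) \esum_(j in [set: T2]) a i j =
  \esum_(j in [set: T2]) \esum_(i in [set: T1]) a i j.
Proof.
move=> a0; rewrite !esum_esum//.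
rewrite (@reindex_esum _ _ _ ([set: T2] `*`` fun=> [set: T1]) _ (fun z => (z.2, z.1)))//.
split => //=.
- by move=> [x y] [x' y'] _ _ [-> ->].
- by move=> [x y] _; exists (y, x).
Qed.

Lemma esum_geometric_le (rho : R) (Y : \bar R) : (0 < rho < 1)%R -> 0 <= Y ->
  \esum_(j in [set: nat]) ((rho ^+ j)%R%:E * Y) <= ((1 - rho)^-1)%R%:E * Y.
Proof.
move=> /andP[r0 r1] Y0; have r10 : (0 < (1 - rho)^-1)%R by rewrite invr_gt0 subr_gt0.
have [->|Yoo] := eqVneq Y +oo; first by rewrite gt0_muley ?lte_fin// leey.
have Yf : Y \is a fin_num by rewrite ge0_fin_numE// ltey.
have rj j : 0 <= (rho ^+ j)%R%:E :> \bar R by rewrite lee_fin exprn_ge0// ltW.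
rewrite -nneseries_esumT; last by move=> j; exact: mule_ge0.
rewrite -(fineK Yf) muleC.
under eq_eseriesr do rewrite muleC.
rewrite nneseriesZl//; apply: lee_wpmul2l; first by rewrite lee_fin fine_ge0.
apply: lime_le; first exact: is_cvg_nneseries.
apply: nearW => N; rewrite sumEFin lee_fin.
have := @geometric_le_lim R N 1 rho ler01 r0; rewrite gtr0_norm// mul1r => /(_ r1).
by rewrite /series/=; under eq_bigr do rewrite mul1r.
Qed.

(** Iteration bounds [x k] by the sum of [rho^j y (k + j)] plus a remainder, and exchanging the sums
    leaves a geometric series. The last hypothesis kills the remainder; it excludes
    [x k = rho^(-k)], which solves the recursion with [y = 0]. *)
Lemma esum_recursion_le (x y : int -> \bar R) (rho : R) : (0 < rho < 1)%R ->
  (forall k, 0 <= x k) -> (forall k, 0 <= y k) ->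
  (forall k, x k <= rho%:E * x (k + 1)%R + y k) ->
  (forall k (e : R), (0 < e)%R ->
    exists J : nat, (rho ^+ J)%R%:E * x (k + J%:Z)%R <= e%:E) ->
  \esum_(k in [set: int]) x k <= ((1 - rho)^-1)%R%:E * \esum_(k in [set: int]) y k.
Proof.
move=> r01 x0 y0 xy tail; have /andP[r0 r1] := r01.
have rj j : 0 <= (rho ^+ j)%R%:E :> \bar R by rewrite lee_fin exprn_ge0// ltW.
have it k J : x k <= \sum_(0 <= j < J) (rho ^+ j)%R%:E * y (k + j%:Z)%R
                      + (rho ^+ J)%R%:E * x (k + J%:Z)%R.
  elim: J => [|J IH].
    by rewrite big_geq// add0e expr0 mul1e addr0.
  apply: (le_trans IH); rewrite big_nat_recr//= -addeA; apply: leeD => //.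
  rewrite exprSr EFinM -muleA addeC -ge0_muleDr//; last by rewrite mule_ge0// lee_fin ltW.
  apply: lee_wpmul2l => //; apply: (le_trans (xy _)).
  by rewrite -addn1 PoszD addrA.
pose S k := \esum_(j in [set: nat]) ((rho ^+ j)%R%:E * y (k + j%:Z)%R).
have xS k : x k <= S k.
  apply/lee_addgt0Pr => e e0; have [J hJ] := tail k e e0.
  apply: (le_trans (it k J)); apply: leeD => //.
  rewrite /S -nneseries_esumT; last by move=> j; exact: mule_ge0.
  by apply: nneseries_lim_ge => j _ _; exact: mule_ge0.
apply: (@le_trans _ _ (\esum_(k in [set: int]) S k)); first by apply: le_esum => k _.
rewrite /S esum_swap; last by move=> k j; exact: mule_ge0.
have Y0 : 0 <= \esum_(k in [set: int]) y k by exact: esum_ge0.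
apply: le_trans (esum_geometric_le r01 Y0); apply: le_esum => j _.
apply: (le_trans (esumZl_le _ _)) => //; first by rewrite exprn_ge0// ltW.
by rewrite esum_int_shift.
Qed.

End discrete.

(** * Dyadic radii and the inequality for sequences *)

Section dyadic.
Context {R : realType}.

Definition rad (k : int) : R := 2 `^ k%:~R.

Lemma rad_gt0 k : 0 < rad k. Proof. exact: powR_gt0. Qed.

Lemma rad_neq0 k : rad k != 0. Proof. by rewrite gt_eqF// rad_gt0. Qed.

Lemma radD k j : rad (k + j) = rad k * rad j.
Proof. by rewrite /rad intrD powRD// pnatr_eq0 implybT. Qed.

Lemma rad1 : rad 1 = 2. Proof. by rewrite /rad powRr1. Qed.

Lemma rad_ge1 k : 0 <= k -> 1 <= rad k.
Proof. by move=> k0; rewrite /rad -[leLHS](powRr0 2) ler_powR ?ler1n// ler0z. Qed.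

Lemma rad_nat_powR (J : nat) (a : R) : rad J%:Z `^ a = (2 `^ a) ^+ J.
Proof. by rewrite /rad -powRrM mulrC powRrM powR_mulrn// powR_ge0. Qed.

Lemma powR2_subr1 k : 2 `^ (k%:~R - 1) = rad k / 2.
Proof. by rewrite /rad powRD ?pnatr_eq0 ?implybT// powR_inv1. Qed.

Local Opaque rad powR.

Lemma radS k : rad (k + 1) = 2 * rad k. Proof. by rewrite radD rad1 mulrC. Qed.

Lemma radB1 k : rad (k - 1) = rad k / 2.
Proof. by rewrite -[in RHS](subrK 1 k) radS mulrC mulKf. Qed.

Lemma rad_powRD k a b : rad k `^ (a + b) = rad k `^ a * rad k `^ b.
Proof. by rewrite powRD// rad_neq0 implybT. Qed.

Lemma rad_powRM k a b : (rad k `^ a) `^ b = rad k `^ (a * b).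
Proof. by rewrite powRrM. Qed.

Lemma rad_shift k j w : rad k `^ w = rad (k + j) `^ w * rad j `^ (- w).
Proof.
have h : rad j `^ w * rad j `^ (- w) = 1 by rewrite -rad_powRD subrr powRr0.
rewrite radD (powRM _ (ltW (rad_gt0 k)) (ltW (rad_gt0 j))) -mulrA.
by rewrite [X in _ = _ * X]h [RHS]mulr1.
Qed.

Lemma esum_rad_shift_le (z : int -> \bar R) (w t : R) (j : int) : (forall k, 0 <= z k)%E ->
  (\esum_(k in [set: int]) ((rad k `^ w)%:E * (z (k + j)%R) `^ t) <=
   (rad j `^ (- w))%:E * \esum_(k in [set: int]) ((rad k `^ w)%:E * (z k) `^ t))%E.
Proof.
move=> z0; have h k : (0 <= (rad k `^ w)%:E * (z k) `^ t)%E.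
  by rewrite mule_ge0 ?poweR_ge0// lee_fin powR_ge0.
rewrite -[X in (_ <= _ * X)%E](esum_int_shift _ j).
apply: le_trans (esumZl_le (powR_ge0 _ _) (fun k => h (k + j)%R)).
by apply: le_esum => k _; rewrite muleA -EFinM (rad_shift k j w) [X in (X%:E * _)%E]mulrC.
Qed.

Lemma rad_term_bound (z : \bar R) k (al t I : R) : 0 < t -> (0 <= z)%E ->
  ((rad k `^ (al * t))%:E * z `^ t <= I%:E)%E -> (z <= (I `^ t^-1 * rad k `^ (- al))%:E)%E.
Proof.
move=> t0 z0 h.
have t1 : 0 <= t^-1 by rewrite invr_ge0 ltW.
have := le_poweR t1 _ h; rewrite mule_ge0 ?poweR_ge0 ?lee_fin ?powR_ge0// => /(_ isT).
rewrite poweRM ?poweR_ge0 ?lee_fin ?powR_ge0// -poweRrM mulfV ?gt_eqF// poweRe1//.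
rewrite !poweR_EFin rad_powRM -mulrA mulfV ?gt_eqF// mulr1 => h2.
have := @lee_wpmul2l _ (rad k `^ (- al))%:E _ _ _ h2.
rewrite lee_fin powR_ge0 muleA -EFinM -rad_powRD addNr powRr0 mul1e => /(_ isT).
by rewrite -EFinM mulrC.
Qed.

Lemma rad_bound4 (z : int -> \bar R) (Z w : R) : 0 <= Z ->
  (forall k, z k <= (Z * rad k `^ w)%:E)%E ->
  exists2 A, 0 <= A & forall k,
    (z (k - 1)%R + z k + (z (k + 1)%R + z (k + 1 + 1)%R) <= (A * rad k `^ w)%:E)%E.
Proof.
move=> Z0 zZ; pose c j := Z * rad j `^ w.
have c0 j : 0 <= c j by rewrite mulr_ge0// powR_ge0.
have hc k j : (z (k + j)%R <= (c j * rad k `^ w)%:E)%E.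
  apply: (le_trans (zZ _)).
  rewrite radD (powRM _ (ltW (rad_gt0 k)) (ltW (rad_gt0 j))) lee_fin /c.
  by rewrite mulrA [leRHS]mulrAC.
clearbody c; exists (c (-1) + c 0 + (c 1 + c (1 + 1))).
  by rewrite !addr_ge0.
move=> k; rewrite 3!mulrDl 3!EFinD.
have := hc k 0; rewrite addr0 => hk.
have := hc k (1 + 1); rewrite (addrA k 1 1) => hk2.
exact: (leeD (leeD (hc k (-1)) hk) (leeD (hc k 1) hk2)).
Qed.

(* The parameters of the statement; [m] is the dimension. *)
Context (m : nat) (u q v r s th al1 al2 al3 sg : R).
Hypotheses (u1 : 1 <= u) (q0 : 0 < q) (v0 : 0 < v) (r0 : 0 < r) (s0 : 0 < s).
Hypotheses (th0 : 0 <= th) (th1 : th <= 1).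
Let gam := m%:R / q + al1.
Let del := m%:R / u + al3.
Hypotheses (del0 : 0 < del) (gam0 : 0 < gam).
Hypothesis al1E : al1 = th * sg + (1 - th) * al3.
Hypothesis gamE : gam = th * (m%:R + al2 - 1) + del * (1 - th).
Hypothesis rE : r^-1 = th / s + (1 - th) / v.
Let d := al2 - sg.
Let p := r / q.
(** Below [r * gam], so that [rho < 1], and below [r * del], so that [rho] still beats the a priori
    growth of the sequence ([W_lt]). *)
Let eps := Num.min (r * gam) (r * del) / 2.
(* Raising the recursion to the power [p] costs the factor [(1 + e) `^ (p + r)],
   which this choice of [e] makes equal to [2 `^ eps]. *)
Let e := 2 `^ (eps / (p + r)) - 1.
Let rho := 2 `^ (eps - r * gam).

Let u0 : 0 < u. Proof. exact: lt_le_trans u1. Qed.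
Let p0 : 0 < p. Proof. exact: divr_gt0. Qed.
Let uN0 : u != 0. Proof. by rewrite gt_eqF. Qed.
Let qN0 : q != 0. Proof. by rewrite gt_eqF. Qed.
Let rN0 : r != 0. Proof. by rewrite gt_eqF. Qed.
Let sN0 : s != 0. Proof. by rewrite gt_eqF. Qed.
Let vN0 : v != 0. Proof. by rewrite gt_eqF. Qed.

Let eps0 : 0 < eps.
Proof. by rewrite divr_gt0// lt_min !mulr_gt0. Qed.

Let eps_gam : eps < r * gam.
Proof.
have : Num.min (r * gam) (r * del) <= r * gam by rewrite ge_min lexx.
by move: eps0; rewrite /eps; lra.
Qed.

Let eps_del : eps < r * del.
Proof.
have : Num.min (r * gam) (r * del) <= r * del by rewrite ge_min lexx orbT.
by move: eps0; rewrite /eps; lra.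
Qed.

Let powR2_gt1 (x : R) : 0 < x -> 1 < 2 `^ x.
Proof.
move=> x0; rewrite -[ltLHS](_ : 1 `^ x = 1); last by rewrite powR1.
by apply: gt0_ltr_powR => //; rewrite ?nnegrE// ltr1n.
Qed.

Let powR2_lt1 (x : R) : x < 0 -> 2 `^ x < 1.
Proof.
move=> x0; rewrite -[x]opprK powRN invf_lt1 ?powR_gt0//.
by apply: powR2_gt1; rewrite oppr_gt0.
Qed.

Lemma dyadic_e_gt0 : 0 < e.
Proof.
have pr : 0 < eps / (p + r) by rewrite divr_gt0// addr_gt0.
by rewrite subr_gt0 powR2_gt1.
Qed.
Let e0 := dyadic_e_gt0.

Let rho01 : 0 < rho < 1.
Proof. by rewrite powR_gt0//= powR2_lt1// subr_lt0. Qed.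

Let one_e : 1 + e = 2 `^ (eps / (p + r)).
Proof. by rewrite /e addrC subrK. Qed.

(** Weights of the discrete Hoelder inequality; the relation for [r^-1] says that they add up to
    1. *)
Let l1 := r * th / s.
Let l2 := r * (1 - th) / v.
Let thC : 0 <= 1 - th. Proof. by rewrite subr_ge0. Qed.
Let l10 : 0 <= l1. Proof. exact: divr_ge0 (mulr_ge0 (ltW r0) th0) (ltW s0). Qed.
Let l20 : 0 <= l2. Proof. exact: divr_ge0 (mulr_ge0 (ltW r0) thC) (ltW v0). Qed.
Let l12 : l1 + l2 = 1.
Proof. by rewrite /l1 /l2 -!mulrA -mulrDr -rE mulfV. Qed.

Let K1 := (1 + e) `^ q * 2 ^- m.
Let w1 := q * th.
Let w2 := q * (1 - th) / u.
Let w10 : 0 <= w1. Proof. exact: mulr_ge0 (ltW q0) th0. Qed.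
Let w20 : 0 <= w2. Proof. exact: divr_ge0 (mulr_ge0 (ltW q0) thC) (ltW u0). Qed.

Section sequences.
(** To be instantiated with the integrals over the shell [k] of [grad_norm f], [|f|^u] and [|f|^q],
    and with that of [|f|] over the shells [k - 1], [k], [k + 1]. *)
Variables (K2 : R) (a b c F : int -> \bar R).
Hypotheses (a0 : forall k, (0 <= a k)%E) (b0 : forall k, (0 <= b k)%E).
Hypotheses (c0 : forall k, (0 <= c k)%E) (F0 : forall k, (0 <= F k)%E) (K20 : 0 <= K2).

Let N k := (a (k - 1) + a k + (a (k + 1) + a (k + 1 + 1)))%R%E.
Let B k := (b k + b (k + 1)%R)%E.
Let N0 k : (0 <= N k)%E. Proof. by rewrite !adde_ge0. Qed.
Let B0 k : (0 <= B k)%E. Proof. by rewrite adde_ge0. Qed.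

Hypothesis rec : forall k, (c k <= K1%:E * c (k + 1)%R +
  K2%:E * ((rad k `^ (w1 * d))%:E * N k `^ w1 * B k `^ w2))%E.

(** The [r]-th power of the [M_k] of the overview. *)
Let x k := ((rad k `^ (al1 * r))%:E * c k `^ p)%E.
Let SP := (\esum_(k in [set: int]) ((rad k `^ (al2 * s))%:E * a k `^ s))%E.
Let SQ := (\esum_(k in [set: int]) ((rad k `^ (al3 * v))%:E * b k `^ (v / u)))%E.

Let P' k := ((rad k `^ (al2 * s))%:E * N k `^ s)%E.
Let Q' k := ((rad k `^ (al3 * v))%:E * B k `^ (v / u))%E.
Let K3 := (1 + e^-1) `^ p * K2 `^ p.
Let y k := (K3%:E * (P' k `^ l1 * Q' k `^ l2))%E.

Let x_rec k : (x k <= rho%:E * x (k + 1)%R + y k)%E.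
Proof.
have rk z : (0 <= (rad k `^ z)%:E :> \bar R)%E by rewrite lee_fin powR_ge0.
have K10 : 0 <= K1 by rewrite mulr_ge0 ?powR_ge0// invr_ge0 exprn_ge0.
pose Z := ((rad k `^ (w1 * d))%:E * N k `^ w1 * B k `^ w2)%E.
have Z0 : (0 <= Z)%E by rewrite !mule_ge0 ?poweR_ge0.
have h1 : (c k `^ p <= ((1 + e) `^ p)%:E * (K1%:E * c (k + 1)%R) `^ p +
    ((1 + e^-1) `^ p)%:E * (K2%:E * Z) `^ p)%E.
  apply: (le_trans (le_poweR (ltW p0) (c0 k) (rec k))).
  by apply: poweR_add_le => //; rewrite mule_ge0.
apply: (le_trans (lee_wpmul2l (rk (al1 * r)) h1)).
have K10e : (0 <= K1%:E)%E by rewrite lee_fin.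
have K20e : (0 <= K2%:E)%E by rewrite lee_fin.
rewrite (poweRM _ K10e (c0 _)) (poweRM _ K20e Z0) ge0_muleDr; last 2 first.
- by rewrite !mule_ge0 ?poweR_ge0 ?lee_fin ?powR_ge0.
- by rewrite !mule_ge0 ?poweR_ge0 ?lee_fin ?powR_ge0.
rewrite !poweR_EFin !muleA -!EFinM; apply: leeD.
  (* Passing from [k + 1] to [k] in the weight gives 2^(- al1 r) and the Jacobian gives 2^(- m p),
     together 2^(- r gam); the powers of [1 + e] give 2^eps, since [p + q p = p + r]. *)
  rewrite le_eqVlt; apply/orP; left; apply/eqP; congr (_%:E * _)%E.
  rewrite radS (powRM _ (ler0n _ _) (ltW (rad_gt0 k))) mulrA -[LHS]mulrA [LHS]mulrC; congr (_ * _).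
  rewrite /K1 powRM ?powR_ge0 ?invr_ge0 ?exprn_ge0// mulrA one_e -!powRrM.
  have -> : (2 ^- m : R) = 2 `^ (- m%:R) by rewrite powRN powR_mulrn.
  rewrite -!powRrM -!powRD; try by rewrite pnatr_eq0 implybT.
  congr (_ `^ _).
  have pr : p + r != 0 by rewrite gt_eqF// addr_gt0.
  have qp : q * p = r by rewrite /p mulrC divfK.
  have rg : r * gam = m%:R * p + al1 * r by rewrite /gam /p; field.
  transitivity (eps / (p + r) * (p + q * p) - m%:R * p); first by ring.
  by rewrite qp rg divfK//; ring.
rewrite /y /K3 EFinM le_eqVlt; apply/orP; left; apply/eqP.
have -> : (Z `^ p = (rad k `^ (w1 * d * p))%:E * N k `^ (w1 * p) * B k `^ (w2 * p))%E.
  by rewrite /Z !poweRM ?mule_ge0 ?poweR_ge0// poweR_EFin rad_powRM -!poweRrM.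
have -> : (P' k `^ l1 = (rad k `^ (al2 * s * l1))%:E * N k `^ (s * l1))%E.
  by rewrite /P' poweRM ?poweR_ge0// poweR_EFin rad_powRM -poweRrM.
have -> : (Q' k `^ l2 = (rad k `^ (al3 * v * l2))%:E * B k `^ (v / u * l2))%E.
  by rewrite /Q' poweRM ?poweR_ge0// poweR_EFin rad_powRM -poweRrM.
have -> : w1 * p = s * l1 by rewrite /w1 /p /l1; field; rewrite sN0 qN0.
have -> : w2 * p = v / u * l2 by rewrite /w2 /p /l2; field; rewrite qN0 uN0 vN0.
set X := (N k `^ _)%E; set W := (B k `^ _)%E.
rewrite (muleACA _ X) -[X in (_ * X = _)%E]muleA [LHS]muleA [RHS]muleA.
congr (_ * _)%E; rewrite -!EFinM; congr EFin.
transitivity ((1 + e^-1) `^ p * K2 `^ p * (rad k `^ (al1 * r) * rad k `^ (w1 * d * p))).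
  by ring.
rewrite -!rad_powRD; congr (_ * rad k `^ _).
(* After division by [r] the exponents of [rad k] read al1 + th d = th al2 + (1 - th) al3, which is
   the definition of [al1]. *)
by rewrite /w1 /d /p /l1 /l2 al1E; field; rewrite qN0 sN0 vN0.
Qed.

(** Each term collects the change of weight caused by one shift of the index; the leading factor is
    the price of opening the sum of four, respectively two, shells. *)
Let cP := 4 `^ s * (rad (-1) `^ (- (al2 * s)) + rad 0 `^ (- (al2 * s)) +
  (rad 1 `^ (- (al2 * s)) + rad (1 + 1) `^ (- (al2 * s)))).
Let cQ := 2 `^ (v / u) * (rad 0 `^ (- (al3 * v)) + rad 1 `^ (- (al3 * v))).
Let vu0 : 0 < v / u. Proof. exact: divr_gt0. Qed.
Let cP0 : 0 <= cP. Proof. by rewrite mulr_ge0 ?powR_ge0// !addr_ge0// powR_ge0. Qed.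
Let cQ0 : 0 <= cQ. Proof. by rewrite mulr_ge0 ?powR_ge0// !addr_ge0// powR_ge0. Qed.

Let SP0 : (0 <= SP)%E.
Proof. by apply: esum_ge0 => k _; rewrite mule_ge0 ?poweR_ge0// lee_fin powR_ge0. Qed.
Let SQ0 : (0 <= SQ)%E.
Proof. by apply: esum_ge0 => k _; rewrite mule_ge0 ?poweR_ge0// lee_fin powR_ge0. Qed.

Let esumP' : (\esum_(k in [set: int]) P' k <= cP%:E * SP)%E.
Proof.
pose T (j k : int) := ((rad k `^ (al2 * s))%:E * a (k + j)%R `^ s)%E.
have T0 j k : (0 <= T j k)%E by rewrite mule_ge0 ?poweR_ge0// lee_fin powR_ge0.
apply: (@le_trans _ _ (\esum_(k in [set: int])
    ((4 `^ s)%:E * (T (-1)%R k + T 0%R k + (T 1%R k + T (1 + 1)%R k))))%E).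
  apply: le_esum => k _; rewrite /P' /T addr0 (addrA k 1 1).
  rewrite -!ge0_muleDr ?adde_ge0 ?poweR_ge0// muleCA.
  by apply: lee_wpmul2l; [rewrite lee_fin powR_ge0|exact: poweR_add4_le].
apply: (le_trans (esumZl_le (powR_ge0 _ _) _)); first by move=> k; rewrite !adde_ge0.
rewrite EFinM -muleA; apply: lee_wpmul2l; first by rewrite lee_fin powR_ge0.
rewrite !esumD//; try by move=> k _; rewrite adde_ge0.
rewrite !EFinD !ge0_muleDl ?adde_ge0 ?lee_fin ?powR_ge0//.
by apply: leeD; apply: leeD; exact: esum_rad_shift_le.
Qed.

Let esumQ' : (\esum_(k in [set: int]) Q' k <= cQ%:E * SQ)%E.
Proof.
pose T (j k : int) := ((rad k `^ (al3 * v))%:E * b (k + j)%R `^ (v / u))%E.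
have T0 j k : (0 <= T j k)%E by rewrite mule_ge0 ?poweR_ge0// lee_fin powR_ge0.
apply: (@le_trans _ _ (\esum_(k in [set: int]) ((2 `^ (v / u))%:E * (T 0%R k + T 1%R k)))%E).
  apply: le_esum => k _; rewrite /Q' /T addr0.
  rewrite -!ge0_muleDr ?adde_ge0 ?poweR_ge0// muleCA.
  apply: lee_wpmul2l; first by rewrite lee_fin powR_ge0.
  have := poweR_add_le (b0 k) (b0 (k + 1)) vu0 ltr01.
  by rewrite invr1 -ge0_muleDr ?poweR_ge0.
apply: (le_trans (esumZl_le (powR_ge0 _ _) _)); first by move=> k; rewrite !adde_ge0.
rewrite EFinM -muleA; apply: lee_wpmul2l; first by rewrite lee_fin powR_ge0.
rewrite esumD//.
rewrite EFinD ge0_muleDl ?lee_fin ?powR_ge0//.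
by apply: leeD; exact: esum_rad_shift_le.
Qed.

Hypotheses (SPy : (SP < +oo)%E) (SQy : (SQ < +oo)%E).

Let P'0 k : (0 <= P' k)%E. Proof. by rewrite mule_ge0 ?poweR_ge0// lee_fin powR_ge0. Qed.
Let Q'0 k : (0 <= Q' k)%E. Proof. by rewrite mule_ge0 ?poweR_ge0// lee_fin powR_ge0. Qed.
Let K30 : 0 <= K3. Proof. by rewrite mulr_ge0// powR_ge0. Qed.

Let esum_y : (\esum_(k in [set: int]) y k <=
  (K3 * (cP `^ l1 * cQ `^ l2))%:E * (SP `^ l1 * SQ `^ l2))%E.
Proof.
have P'y : (\esum_(k in [set: int]) P' k < +oo)%E.
  by apply: (le_lt_trans esumP'); rewrite lte_mul_pinfty// ge0_fin_numE.
have Q'y : (\esum_(k in [set: int]) Q' k < +oo)%E.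
  by apply: (le_lt_trans esumQ'); rewrite lte_mul_pinfty// ge0_fin_numE.
apply: (le_trans (esumZl_le K30 _)); first by move=> k; rewrite mule_ge0 ?poweR_ge0.
rewrite (EFinM K3) -muleA; apply: lee_wpmul2l; first by rewrite lee_fin.
apply: (le_trans (esum_hoelder P'0 Q'0 l10 l20 l12 P'y Q'y)).
rewrite EFinM muleACA -!poweR_EFin -!poweRM ?lee_fin//.
apply: lee_pmul; rewrite ?poweR_ge0//; apply: le_poweR => //; exact: esum_ge0.
Qed.

Hypothesis growth : forall k, (c k <= ((rad k / 4) `^ (w1 * d))%:E *
  (N k + ((rad k / 4)^-1)%:E * F k) `^ w1 * b k `^ w2)%E.
Hypothesis F_le : forall k (t : R), 0 < t ->
  (F k <= (t * (4 * rad k) ^+ m)%:E +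
          (t * t^-1 `^ u)%:E * (b (k - 1)%R + b k + b (k + 1)%R))%E.

(** In the growth bound [N k] is of order [rad k] to the [- al2] and [F k / rad k] of order
    [m - 1 - del]; [om - al2] is the larger exponent. [W] is the growth exponent that results for
    [x]. *)
Let om := Num.max 0 (m%:R - 1 - del + al2).
Let W := r * th * om.

Let om0 : 0 <= om. Proof. by rewrite le_max lexx. Qed.

Let a_bound : exists2 A0, 0 <= A0 & forall k, (a k <= (A0 * rad k `^ (- al2))%:E)%E.
Proof.
have SPf : SP \is a fin_num by rewrite ge0_fin_numE.
exists (fine SP `^ s^-1); first exact: powR_ge0.
move=> k; apply: rad_term_bound => //; rewrite fineK//.
apply: (@le_esum_term _ _ (fun k => (rad k `^ (al2 * s))%:E * a k `^ s)%E) => j.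
by rewrite mule_ge0 ?poweR_ge0// lee_fin powR_ge0.
Qed.

Let b_bound : exists2 B0, 0 <= B0 & forall k, (b k <= (B0 * rad k `^ (- (al3 * u)))%:E)%E.
Proof.
have SQf : SQ \is a fin_num by rewrite ge0_fin_numE.
exists (fine SQ `^ (v / u)^-1); first exact: powR_ge0.
move=> k; apply: rad_term_bound => //; rewrite fineK//.
have -> : al3 * u * (v / u) = al3 * v by field.
apply: (@le_esum_term _ _ (fun k => (rad k `^ (al3 * v))%:E * b k `^ (v / u))%E) => j.
by rewrite mule_ge0 ?poweR_ge0// lee_fin powR_ge0.
Qed.

Let x_growth : exists2 K, 0 <= K & forall k, 0 <= k -> (x k <= (K * rad k `^ W)%:E)%E.
Proof.
have [A0 A00 ab] := a_bound; have [B00 B000 bb] := b_bound.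
have [A1 A10 Nb] := rad_bound4 A00 ab; have [B1 B10 hB4] := rad_bound4 B000 bb.
have hB k : (b (k - 1)%R + b k + b (k + 1)%R <= (B1 * rad k `^ (- (al3 * u)))%:E)%E.
  by apply: le_trans (hB4 k); apply: leeD => //; rewrite leeDl.
pose F1 := 4 ^+ m + B1.
have F10 : 0 <= F1 by rewrite addr_ge0// exprn_ge0.
have delu : del * u = m%:R + al3 * u by rewrite /del; field.
have Fb k : (F k <= (F1 * rad k `^ (m%:R - del))%:E)%E.
  (* This threshold balances the two terms of [F_le]: both become of order [rad k] to the [m - del],
     because [del u = m + al3 u]. *)
  have t0 : 0 < rad k `^ (- del) by rewrite powR_gt0// rad_gt0.
  apply: (le_trans (F_le k t0)).
  have -> : F1 * rad k `^ (m%:R - del) =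
      4 ^+ m * rad k `^ (m%:R - del) + B1 * rad k `^ (m%:R - del) by rewrite /F1 mulrDl.
  rewrite [leRHS]EFinD; apply: leeD.
    rewrite lee_fin le_eqVlt; apply/orP; left; apply/eqP.
    rewrite exprMn mulrCA -(powR_mulrn m (ltW (rad_gt0 k))) -rad_powRD.
    by rewrite [- del + _]addrC.
  apply: (le_trans (lee_wpmul2l _ (hB k))).
    by rewrite lee_fin mulr_ge0 ?powR_ge0.
  rewrite -EFinM lee_fin le_eqVlt; apply/orP; left; apply/eqP.
  rewrite -powRN opprK rad_powRM [B1 * _]mulrC mulrA -!rad_powRD mulrC; congr (_ * rad k `^ _).
  by rewrite delu; ring.
pose K4 := 4^-1 `^ (w1 * d) * (A1 + 4 * F1) `^ w1 * B00 `^ w2.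
have K40 : 0 <= K4 by rewrite !mulr_ge0 ?powR_ge0.
exists (K4 `^ p); first exact: powR_ge0.
move=> k k0.
(* Radii at least 1 make the larger exponent dominate; the tail is examined only as the index tends
   to infinity. *)
have rk1 := rad_ge1 k0.
have hG : (N k + ((rad k / 4)^-1)%:E * F k <= ((A1 + 4 * F1) * rad k `^ (om - al2))%:E)%E.
  rewrite mulrDl EFinD; apply: leeD.
    apply: (le_trans (Nb k)); rewrite lee_fin ler_wpM2l// ler_powR//.
    by rewrite lerDr.
  apply: (le_trans (lee_wpmul2l _ (Fb k))).
    by rewrite lee_fin invr_ge0 divr_ge0// ltW// rad_gt0.
  rewrite -EFinM lee_fin invfM invrK.
  have -> : (rad k)^-1 * 4 * (F1 * rad k `^ (m%:R - del)) =
      4 * F1 * rad k `^ (-1 + (m%:R - del)).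
    rewrite (rad_powRD k (-1)) -[(rad k)^-1](powR_inv1 (ltW (rad_gt0 k))).
    by ring.
  rewrite ler_wpM2l ?mulr_ge0// ler_powR//.
  have : m%:R - 1 - del + al2 <= om by rewrite le_max lexx orbT.
  by lra.
have cb : (c k <= (K4 * rad k `^ (w1 * d + (om - al2) * w1 - al3 * u * w2))%:E)%E.
  apply: (le_trans (growth k)).
  apply: (@le_trans _ _ (((rad k / 4) `^ (w1 * d))%:E *
      ((A1 + 4 * F1) * rad k `^ (om - al2))%:E `^ w1 *
      (B00 * rad k `^ (- (al3 * u)))%:E `^ w2)%E).
    apply: lee_pmul; rewrite ?poweR_ge0//.
    - by rewrite mule_ge0 ?poweR_ge0// lee_fin powR_ge0.
    - apply: lee_wpmul2l; first by rewrite lee_fin powR_ge0.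
      apply: le_poweR => //; rewrite adde_ge0// mule_ge0// lee_fin invr_ge0 divr_ge0//.
      by rewrite ltW// rad_gt0.
    by apply: le_poweR.
  rewrite !poweR_EFin -!EFinM lee_fin le_eqVlt; apply/orP; left; apply/eqP.
  rewrite (powRM _ (ltW (rad_gt0 k))) ?invr_ge0//.
  rewrite (powRM _ _ (powR_ge0 _ _)) ?addr_ge0 ?mulr_ge0//.
  rewrite (powRM _ B000 (powR_ge0 _ _)) !rad_powRM /K4.
  have -> : w1 * d + (om - al2) * w1 - al3 * u * w2 =
            w1 * d + ((om - al2) * w1 + - (al3 * u) * w2) by ring.
  rewrite (rad_powRD k (w1 * d)) (rad_powRD k ((om - al2) * w1)).
  by ring.
have rk : (0 <= (rad k `^ (al1 * r))%:E :> \bar R)%E by rewrite lee_fin powR_ge0.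
apply: (le_trans (lee_wpmul2l rk (le_poweR (ltW p0) (c0 k) cb))).
rewrite poweR_EFin -EFinM lee_fin (powRM _ K40 (powR_ge0 _ _)) rad_powRM.
rewrite mulrCA -rad_powRD le_eqVlt; apply/orP; left; apply/eqP; congr (_ * rad k `^ _).
by rewrite /W /w1 /w2 /d /p al1E; field; rewrite uN0 qN0.
Qed.

(** If [om = 0] this is [eps < r gam]. Otherwise the relation [gamE] turns [W] into [r gam - r del],
    and the positivity of [del] leaves room for [eps]. *)
Let W_lt : W < r * gam - eps.
Proof.
rewrite /W /om; have [h|/ltW h] := leP (m%:R - 1 - del + al2) 0.
  by rewrite mulr0 subr_gt0.
have -> : r * th * (m%:R - 1 - del + al2) = r * gam - r * del by rewrite gamE; ring.
by rewrite ltrD2l ltrN2.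
Qed.

Let x_tail k (e1 : R) : 0 < e1 ->
  exists J : nat, ((rho ^+ J)%:E * x (k + J%:Z)%R <= e1%:E)%E.
Proof.
move=> e10; have [K K0 xK] := x_growth.
pose tau := 2 `^ (eps - r * gam + W).
have tau0 : 0 < tau by exact: powR_gt0.
have tau1 : tau < 1 by rewrite powR2_lt1//; move: W_lt; lra.
have : `|tau| < 1 by rewrite gtr0_norm.
move=> /(cvg_geometric (K * rad k `^ W)) /cvgr0Pnorm_lt/(_ _ e10)[M _ hM].
(* Adding [|k|] makes [k + J] nonnegative, where [x_growth] applies; there the remainder is a
   multiple of [tau^J] with [tau = rho 2^W < 1]. *)
pose J := (M + `|k|%N)%N; exists J.
have kJ : 0 <= k + J%:Z.
  rewrite /J PoszD addrCA addr_ge0// -lerBlDl sub0r abszE.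
  by rewrite -normrN ler_norm.
apply: (@le_trans _ _ ((rho ^+ J)%:E * (K * rad (k + J%:Z) `^ W)%:E)%E).
  apply: lee_wpmul2l; last exact: xK.
  by rewrite lee_fin exprn_ge0// powR_ge0.
have /= := hM J (leq_addr _ _); rewrite ger0_norm; last first.
  by rewrite !mulr_ge0 ?powR_ge0// exprn_ge0// ltW.
move=> h; rewrite -EFinM lee_fin; apply: le_trans (ltW h).
rewrite radD (powRM _ (ltW (rad_gt0 k)) (ltW (rad_gt0 J))).
rewrite rad_nat_powR.
have -> : tau = rho * 2 `^ W by rewrite /tau powRD// pnatr_eq0 implybT.
rewrite exprMn le_eqVlt; apply/orP; left; apply/eqP.
by ring.
Qed.

Lemma dyadic_interpolation :
  (\esum_(k in [set: int]) ((rad k `^ (al1 * r))%:E * c k `^ p) <=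
  ((1 - rho)^-1 * (K3 * (cP `^ l1 * cQ `^ l2)))%:E * (SP `^ l1 * SQ `^ l2))%E.
Proof.
have x0 k : (0 <= x k)%E by rewrite mule_ge0 ?poweR_ge0// lee_fin powR_ge0.
have y0 k : (0 <= y k)%E.
  by rewrite mule_ge0 ?lee_fin// mule_ge0 ?poweR_ge0.
apply: (le_trans (esum_recursion_le rho01 x0 y0 x_rec x_tail)).
rewrite EFinM -muleA; apply: lee_wpmul2l; last exact: esum_y.
by rewrite lee_fin invr_ge0 subr_ge0 ltW//; case/andP: rho01.
Qed.

End sequences.

(** The order of quantifiers matters: [e] comes from the exponents alone, [K2] will depend on [e],
    and [C] is fixed before the sequences, hence uniform in [f]. *)
Lemma dyadic_interpolation_ex : exists2 e : R, 0 < e & forall K2, 0 <= K2 ->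
  exists2 C : R, 0 < C & forall a b c F : int -> \bar R,
  (forall k, 0 <= a k)%E -> (forall k, 0 <= b k)%E ->
  (forall k, 0 <= c k)%E -> (forall k, 0 <= F k)%E ->
  (forall k, c k <= ((1 + e) `^ q * 2 ^- m)%R%:E * c (k + 1)%R +
    K2%:E * ((rad k `^ (q * th * (al2 - sg)))%:E *
      (a (k - 1)%R + a k + (a (k + 1)%R + a (k + 1 + 1)%R)) `^ (q * th) *
      (b k + b (k + 1)%R) `^ (q * (1 - th) / u)))%E ->
  (\esum_(k in [set: int]) ((rad k `^ (al2 * s))%:E * a k `^ s) < +oo)%E ->
  (\esum_(k in [set: int]) ((rad k `^ (al3 * v))%:E * b k `^ (v / u)) < +oo)%E ->
  (forall k, c k <= ((rad k / 4) `^ (q * th * (al2 - sg)))%:E *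
    (a (k - 1)%R + a k + (a (k + 1)%R + a (k + 1 + 1)%R) + ((rad k / 4)^-1)%:E * F k)
      `^ (q * th) * b k `^ (q * (1 - th) / u))%E ->
  (forall k (t : R), (0 < t)%R -> F k <= (t * (4 * rad k) ^+ m)%R%:E +
    (t * t^-1 `^ u)%R%:E * (b (k - 1)%R + b k + b (k + 1)%R))%E ->
  (\esum_(k in [set: int]) ((rad k `^ (al1 * r))%:E * c k `^ (r / q)) <=
   C%:E * ((\esum_(k in [set: int]) ((rad k `^ (al2 * s))%:E * a k `^ s)) `^ (r * th / s) *
     (\esum_(k in [set: int]) ((rad k `^ (al3 * v))%:E * b k `^ (v / u)))
       `^ (r * (1 - th) / v)))%E.
Proof.
exists e => // K2 K20.
pose C0 := (1 - rho)^-1 * ((1 + e^-1) `^ p * K2 `^ p * ((4 `^ s * (rad (-1) `^ (- (al2 * s)) +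
  rad 0 `^ (- (al2 * s)) + (rad 1 `^ (- (al2 * s)) + rad (1 + 1) `^ (- (al2 * s))))) `^ l1 *
  (2 `^ (v / u) * (rad 0 `^ (- (al3 * v)) + rad 1 `^ (- (al3 * v)))) `^ l2)).
have C00 : 0 <= C0.
  by rewrite !mulr_ge0 ?powR_ge0// invr_ge0 subr_ge0 ltW//; case/andP: rho01.
(* [C0] vanishes when [K2] does; adding 1 makes the constant positive. *)
exists (C0 + 1); first by rewrite ltr_wpDl.
move=> a b c F a0 b0 c0 F0 rec SPy SQy growth F_le.
apply: (le_trans (dyadic_interpolation a0 b0 c0 F0 K20 rec SPy SQy growth F_le)).
apply: lee_wpmul2r; first by rewrite mule_ge0 ?poweR_ge0.
by rewrite lee_fin lerDl.
Qed.

End dyadic.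

(** * Herz norms as sums of integrals over shells *)

Section herz.
Context {R : realType}.

Lemma iint_restr n k (p : R) (g : 'rV[R]_n -> R) : 0 < p ->
  iint (fun x => (`|restr k g x| `^ p)%:E) =
  aint (rad k / 2) (rad k) (fun x => `|g x| `^ p).
Proof.
move=> p0; apply: eq_iint => x; congr EFin; rewrite /restr /mask.
have -> : `[< shell k x >] = (rad k / 2 <= eucl x) && (eucl x < rad k).
  by rewrite -powR2_subr1; apply/asboolP/idP.
by case: ifP => // _; rewrite normr0 powR0// gt_eqF.
Qed.

Lemma herz_normE n (al p t : R) (g : 'rV[R]_n -> R) : 0 < p ->
  herz_norm al p t g = ((\esum_(k in [set: int]) ((rad k `^ (al * t))%:E *
    (aint (rad k / 2) (rad k) (fun x => `|g x| `^ p)%R) `^ (t / p))) `^ t^-1)%E.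
Proof.
move=> p0; congr poweR; apply: eq_esum => k _.
rewrite /Lpnorm iint_restr// -poweRrM [p^-1 * t]mulrC; congr (_%:E * _)%E.
by rewrite /rad -powRrM mulrA.
Qed.

Definition shint n (h : 'rV[R]_n -> R) (k : int) : \bar R := aint (rad k / 2) (rad k) h.

Section shells.
Context n (h : 'rV[R]_n -> R).
Local Notation A := (shint h).

Lemma aint_shellB k : aint (rad k / 4) (rad k / 2) h = A (k - 1).
Proof. by rewrite /shint radB1 -mulrA -invfM -natrM. Qed.

Lemma aint_shellS k : aint (rad k) (2 * rad k) h = A (k + 1).
Proof. by rewrite /shint radS [2 * rad k]mulrC mulfK. Qed.

Lemma aint_shellSS k : aint (2 * rad k) (4 * rad k) h = A (k + 1 + 1).
Proof. by rewrite -aint_shellS radS mulrA -natrM. Qed.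

Hypotheses (mh : rmeas h) (h0 : forall x, 0 <= h x).

Lemma aint_shell3 k :
  (aint (rad k / 4) (2 * rad k) h = A (k - 1)%R + A k + A (k + 1)%R)%E.
Proof.
have r0 := rad_gt0 (R := R) k.
have h1 : rad k / 4 <= rad k / 2 :> R by lra.
have h2 : rad k / 2 <= rad k :> R by lra.
have h3 : rad k <= 2 * rad k :> R by lra.
rewrite -aint_shellB -aint_shellS (aint_split mh h0 (le_trans h1 h2) h3).
by rewrite (aint_split mh h0 h1 h2).
Qed.

Lemma aint_shell4 k :
  (aint (rad k / 4) (4 * rad k) h = A (k - 1)%R + A k + (A (k + 1)%R + A (k + 1 + 1)%R))%E.
Proof.
have r0 := rad_gt0 (R := R) k.
have h1 : rad k / 4 <= 2 * rad k :> R by lra.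
have h2 : 2 * rad k <= 4 * rad k :> R by lra.
by rewrite -aint_shellSS addeA -aint_shell3 (aint_split mh h0 h1 h2).
Qed.

End shells.
End herz.

Theorem theorem2p13 (R : realType) (n : nat)
  (u q v r s theta alpha1 alpha2 alpha3 sigma : R) :
  1 <= u -> 0 < q -> 0 < v -> 0 < r -> 0 < s ->
  0 <= theta <= 1 ->
  0 < n%:R + alpha2 ->
  0 < n%:R / u + alpha3 ->
  0 < n%:R / q + alpha1 ->
  sigma <= alpha2 <= sigma + 1 ->
  alpha1 = theta * sigma + (1 - theta) * alpha3 ->
  n%:R / q + alpha1 = theta * (n%:R + alpha2 - 1) + (n%:R / u + alpha3) * (1 - theta) ->
  r^-1 = theta / s + (1 - theta) / v ->
  exists c : R, 0 < c /\
    forall f : 'rV[R]_n -> R, C1 f ->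
      (herz_norm alpha2 1 s (grad_norm f) < +oo)%E ->
      (herz_norm alpha3 u v f < +oo)%E ->
      (herz_norm alpha1 q r f <=
         c%:E * (herz_norm alpha2 1 s (grad_norm f)) `^ theta
              * (herz_norm alpha3 u v f) `^ (1 - theta))%E.
Proof.
move=> u1 q0 v0 r0 s0 th01 _ del0 gam0 /andP[sa as1] al1E gamE rE.
have /andP[th0 th1] := th01.
(* In dimension zero the only point has radius 0 and lies in no shell, so the left side is 0. *)
case: n del0 gam0 gamE => [|n] del0 gam0 gamE.
  exists 1; split=> // f _ _ _.
  rewrite herz_normE// esum1.
    by rewrite poweR0r ?invr_neq0 ?gt_eqF// !mule_ge0// poweR_ge0.
  move=> k _; rewrite (_ : aint _ _ _ = 0%E); last first.
    rewrite /aint /= /mask /eucl big_ord0 sqrtr0.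
    by rewrite leNgt divr_gt0 ?rad_gt0.
  by rewrite poweR0r ?mule0// gt_eqF// divr_gt0.
have u0 : 0 < u by exact: lt_le_trans u1.
set d := alpha2 - sigma.
have d01 : 0 <= d <= 1 by rewrite /d; apply/andP; split; lra.
(* The Hoelder weights add up to 1: insert [al1E] into [gamE], which removes [alpha3], and multiply
   by [q / n.+1]. *)
have hq : q * theta * d + q * (1 - theta) / u +
    n%:R * (q * theta * (1 - d) / n.+1%:R) = 1.
  have nE : n%:R = n.+1%:R - 1 :> R by rewrite -natr1 addrK.
  have n0 : n.+1%:R != 0 :> R by rewrite pnatr_eq0.
  rewrite nE; move: (n.+1%:R) n0 gamE => N N0 gamE.
  have E : N / q = theta * (N + alpha2 - 1) + (N / u + alpha3) * (1 - theta) - alpha1.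
    by rewrite -gamE addrK.
  have qN0 : q != 0 by rewrite gt_eqF.
  have uN0 : u != 0 by rewrite gt_eqF.
  transitivity (q / N * (N / q)); last by field; rewrite N0 qN0.
  by rewrite E al1E /d; field; rewrite N0 uN0.
have [e e0 /(_ _)] := dyadic_interpolation_ex u1 q0 v0 r0 s0 th0 th1 del0 gam0 al1E gamE rE.
set K2 := (1 + e^-1) `^ q * 4^-1 `^ (q * theta * d) * (3 + 8 * n.+1%:R) `^ (q * theta)
      * (2 `^ u) `^ (q * (1 - theta) / u).
have K20 : 0 <= K2 by rewrite !mulr_ge0// powR_ge0.
move=> /(_ _ K20)[C C0 main].
exists (C `^ r^-1); split; first exact: powR_gt0.
move=> f f1 gy fy.
pose a := shint (grad_norm f).
pose b := shint (fun x => `|f x| `^ u).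
pose c := shint (fun x => `|f x| `^ q).
pose F k := aint (rad k / 4) (2 * rad k) (fun x => `|f x|).
have mg := rmeas_grad_norm f1.
have g0 := grad_norm_ge0 f.
have mfp p : rmeas (fun x => `|f x| `^ p).
  by apply: rmeas_powR; apply: rmeas_norm; exact: C1_rmeas.
have fp0 p x : 0 <= `|f x| `^ p by exact: powR_ge0.
have gE : herz_norm alpha2 1 s (grad_norm f) =
    ((\esum_(k in [set: int]) ((rad k `^ (alpha2 * s))%:E * a k `^ s)) `^ s^-1)%E.
  rewrite herz_normE//; congr poweR; apply: eq_esum => k _; rewrite divr1.
  congr (_ * aint _ _ _ `^ _)%E; apply/funext => x.
  by rewrite powRr1// ger0_norm.
rewrite gE herz_normE// in gy *; rewrite (herz_normE _ _ _ u0) in fy *.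
set SP := (\esum_(k in _) _)%E in gy *; set SQ := (\esum_(k in _) _)%E in fy *.
have SP0 : (0 <= SP)%E.
  by apply: esum_ge0 => k _; rewrite mule_ge0 ?poweR_ge0// lee_fin powR_ge0.
have SQ0 : (0 <= SQ)%E.
  by apply: esum_ge0 => k _; rewrite mule_ge0 ?poweR_ge0// lee_fin powR_ge0.
have SPy : (SP < +oo)%E by apply: lty_poweRy gy; rewrite invr_neq0// gt_eqF.
have SQy : (SQ < +oo)%E by apply: lty_poweRy fy; rewrite invr_neq0// gt_eqF.
have rec k := aint_powR_recursion f1 (rad_gt0 k) q0 u0 th01 d01 e0 hq.
have growth k := aint_powR_growth f1 (rad_gt0 k) q0 u0 th01 d01 hq.
have Fle k t (t0 : 0 < t) := aint_norm_le f1 (rad_gt0 k) t0 u1.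
have a0 k : (0 <= a k)%E by exact: aint_ge0.
have b0 k : (0 <= b k)%E by apply: aint_ge0 => x; exact: fp0.
have c0 k : (0 <= c k)%E by apply: aint_ge0 => x; exact: fp0.
have F0 k : (0 <= F k)%E by exact: aint_ge0.
have {}main := main a b c F a0 b0 c0 F0.
have {main}H := main _ SPy SQy _ _.
apply: (@le_trans _ _ ((C%:E * (SP `^ (r * theta / s) * SQ `^ (r * (1 - theta) / v)))
    `^ r^-1)%E).
  apply: le_poweR.
  - by rewrite invr_ge0 ltW.
  - by apply: esum_ge0 => k _; rewrite mule_ge0 ?poweR_ge0// lee_fin powR_ge0.
  apply: H => [k|k|k t t0].
  - by have := rec k; rewrite (aint_shell4 mg g0) !aint_shellS.
  - by have := growth k; rewrite (aint_shell4 mg g0).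
  - by have := Fle k t t0; rewrite (aint_shell3 (mfp u) (fp0 u)).
(* The [r]-th root leaves the exponents [theta / s] and [(1 - theta) / v] on the sums, that is
   [theta] and [1 - theta] on the norms. *)
rewrite !poweRM ?mule_ge0 ?poweR_ge0 ?lee_fin ?(ltW C0)// poweR_EFin -!poweRrM muleA.
rewrite (_ : r * theta / s / r = s^-1 * theta); last by field; rewrite !gt_eqF.
by rewrite (_ : r * (1 - theta) / v / r = v^-1 * (1 - theta)); last by field; rewrite !gt_eqF.
Qed.
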